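(* There exist absolute constants $a,b>0$ such that the following holds. Let $0<\epsilon\le\Delta\le1$ and let $G$ be an $n\times n$ bimatrix game with payoff matrices in $[0,1]^{n\times n}$ that has at most $n^{a(\Delta/\epsilon)^2}$ Nash equilibria and that satisfies the well-supported $(\epsilon,\Delta)$-approximation stability condition (or the $(\epsilon/2,\Delta)$-stability to perturbations condition). Then $G$ has a well-supported $\epsilon$-equilibrium $(p,q)$ in which each of $p$ and $q$ has support of size at most $b(\Delta/\epsilon)^2\log(1+\Delta^{-1})\log n$.
   Context: Bimatrix game: row payoff $R_{i,j}$, column payoff $C_{i,j}$; mixed strategies $p,q$ are probability vectors, payoffs $p^TRq$, $p^TCq$; $e_i$ is the $i$-th unit vector; $\mathrm{supp}(p)=\{i:p_i>0\}$. Nash equilibrium: $e_i^TRq\le p^TRq$ and $p^TCe_j\le p^TCq$ for all $i,j$. Well-supported $\epsilon$-equilibrium: for every $i\in\mathrm{supp}(p)$ and all $j$, $e_i^TRq\ge e_j^TRq-\epsilon$, and for every $i\in\mathrm{supp}(q)$ and all $j$, $p^TCe_i\ge p^TCe_j-\epsilon$. Distance $d(p,p')=\frac12\sum_i|p_i-p'_i|$, $d((p,q),(p',q'))=\max(d(p,p'),d(q,q'))$; $\Delta$-close means distance $\le\Delta$. $G'$ is an $L_\infty$ $\alpha$-perturbation of $G$ if all corresponding entries of the row matrices and of the column matrices differ by at most $\alpha$ (entries need not be in $[0,1]$). $(\epsilon,\Delta)$-stability to perturbations: for every $L_\infty$ $\epsilon$-perturbation $G'$ of $G$, every Nash equilibrium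 of $G'$ is $\Delta$-close to some Nash equilibrium of $G$. Well-supported $(\epsilon,\Delta)$-approximation stability: every well-supported $\epsilon$-equilibrium of $G$ is $\Delta$-close to some Nash equilibrium of $G$. $\log$ is the natural logarithm.
   Formalization: The game size is assumed to satisfy n ≥ 2; for n = 1 the claimed support bound is 0 because log n = 0, so the statement fails for every 1×1 game. *)

(* Defs.v *)
(* concrete reals R. Strategies/matrices indexed by nat,
   only indices < n are meaningful. *)
From Stdlib Require Import Reals Lra List.
Import ListNotations.
Open Scope R_scope.

Definition sumR (n : nat) (f : nat -> R) : R :=
  fold_right Rplus 0 (map f (seq 0 n)).

Definition mat := nat -> nat -> R.
Definition vec := nat -> R.

Definition is_strategy (n : nat) (p : vec) : Prop :=
  (forall i, (i < n)%nat -> 0 <= p i) /\ sumR n p = 1.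

Definition bil (n : nat) (A : mat) (p q : vec) : R :=
  sumR n (fun i => p i * sumR n (fun j => A i j * q j)).

Definition row_pay (n : nat) (A : mat) (i : nat) (q : vec) : R :=
  sumR n (fun j => A i j * q j).
Definition col_pay (n : nat) (A : mat) (p : vec) (j : nat) : R :=
  sumR n (fun i => p i * A i j).

Definition is_Nash (n : nat) (Rm Cm : mat) (p q : vec) : Prop :=
  is_strategy n p /\ is_strategy n q /\
  (forall i, (i < n)%nat -> row_pay n Rm i q <= bil n Rm p q) /\
  (forall j, (j < n)%nat -> col_pay n Cm p j <= bil n Cm p q).

Definition is_WS_eq (n : nat) (Rm Cm : mat) (eps : R) (p q : vec) : Prop :=
  is_strategy n p /\ is_strategy n q /\
  (forall i, (i < n)%nat -> 0 < p i ->
     forall j, (j < n)%nat -> row_pay n Rm i q >= row_pay n Rm j q - eps) /\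
  (forall i, (i < n)%nat -> 0 < q i ->
     forall j, (j < n)%nat -> col_pay n Cm p i >= col_pay n Cm p j - eps).

Definition dist (n : nat) (p p' : vec) : R :=
  / 2 * sumR n (fun i => Rabs (p i - p' i)).

Definition close (n : nat) (Delta : R) (p q p' q' : vec) : Prop :=
  Rmax (dist n p p') (dist n q q') <= Delta.

Definition WS_approx_stable (n : nat) (Rm Cm : mat) (eps Delta : R) : Prop :=
  forall p q, is_WS_eq n Rm Cm eps p q ->
    exists p' q', is_Nash n Rm Cm p' q' /\ close n Delta p q p' q'.

Definition is_perturbation (n : nat) (Rm Cm Rm' Cm' : mat) (alpha : R) : Prop :=
  forall i j, (i < n)%nat -> (j < n)%nat ->
    Rabs (Rm' i j - Rm i j) <= alpha /\ Rabs (Cm' i j - Cm i j) <= alpha.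

Definition perturbation_stable (n : nat) (Rm Cm : mat) (eps Delta : R) : Prop :=
  forall Rm' Cm', is_perturbation n Rm Cm Rm' Cm' eps ->
    forall p q, is_Nash n Rm' Cm' p q ->
      exists p' q', is_Nash n Rm Cm p' q' /\ close n Delta p q p' q'.

Definition entries01 (n : nat) (A : mat) : Prop :=
  forall i j, (i < n)%nat -> (j < n)%nat -> 0 <= A i j <= 1.

Definition at_most_N_Nash (n : nat) (Rm Cm : mat) (N : R) : Prop :=
  exists L : list (vec * vec), INR (length L) <= N /\
    forall p q, is_Nash n Rm Cm p q ->
      exists pq, In pq L /\ forall i, (i < n)%nat -> p i = fst pq i /\ q i = snd pq i.

Definition supp_size (n : nat) (p : vec) : nat :=
  length (filter (fun i => if Rlt_dec 0 (p i) then true else false) (seq 0 n)).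

(* Main.v *)
(** Any well-supported [eps / 2]-equilibrium [(p, q)] can be sparsified.  Keep [q] and perturb
    only the entries of [p] below some threshold [x], with total mass [mu], by random signs.
    If [mu >= 34 Delta] and these entries are at most [mu / m] with [m ~ (Delta / eps)^2 ln n],
    one can move [p] by more than [Delta] while changing every payoff by less than [eps / 4].
    The result is a well-supported [eps]-equilibrium, and it lands in a given [Delta]-ball with
    probability at most [exp (- c m)], so the few Nash equilibria cannot account for all
    outcomes, contradicting stability.  Hence [mu < x * m] whenever [mu >= 34 Delta].  Running
    through dyadic thresholds, all but [34 Delta] of the mass of [p] sits on
    [O(m ln (1 + / Delta))] strategies, and the rest is replaced by an empirical average of
    [O(m)] samples, at the cost of [eps / 8] in each payoff.

    An initial approximate equilibrium comes from Scarf's combinatorial lemma.  A well-supported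
    [eps]-equilibrium is an exact one of an [eps / 2]-perturbation, which reduces stability to
    perturbations to approximation stability. *)
Require Import Defs.
From Stdlib Require Import ZArith Reals Lra Lia List Classical.
From mathcomp Require all_boot.
Import ListNotations.
Open Scope R_scope.

(** * Scarf's lemma *)

Module Scarf.
Import all_boot.
Local Open Scope nat_scope.
Set Implicit Arguments.
Unset Strict Implicit.
Unset Printing Implicit Defensive.

Section Dominating.
Variables (T : finType) (n : nat) (r : 'I_n -> T -> nat).
Hypothesis r_inj : forall i, injective (r i).

(** Scarf's dominance: no element exceeds the minima of [B] in all orders at once. Taking [y] in
    [B], each element of [B] is its minimum in some order, so [B] has at most [n] elements. Below,
    those of size [n] act as cells and those of size [n - 1] as facets. *)
Definition dominating (B : {set T}) :=
  [forall y, exists i, [forall x in B, r i y <= r i x]].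

Lemma dominatingP (B : {set T}) :
  reflect (forall y, exists i, forall x, x \in B -> r i y <= r i x)
          (dominating B).
Proof.
apply: (iffP forallP) => [H y|H y].
  have /existsP[i /forall_inP Hi] := H y; by exists i.
have [i Hi] := H y; apply/existsP; exists i; exact/forall_inP.
Qed.

Lemma dominating_sub (A B : {set T}) :
  A \subset B -> dominating B -> dominating A.
Proof.
move=> /subsetP sAB /dominatingP domB; apply/dominatingP => y.
have [i Hi] := domB y; exists i => x xA; exact: Hi (sAB _ xA).
Qed.

(** * Cells around a fixed facet *)

Section Pivot.
Variables (d : {set T}) (m : 'I_n -> T) (i j : 'I_n).
Hypotheses (dom_d : dominating d) (card_d : #|d|.+1 = n).
Hypotheses (m_in : forall k, m k \in d).
Hypothesis (m_min : forall k x, x \in d -> r k (m k) <= r k x).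
Hypotheses (neq_ij : i != j) (m_ij : m i = m j).

(** Adding an element of [above k] to [d] keeps the minimum in every order except possibly [k]; only
    the [k]-largest such element leaves the enlarged set dominating. *)
Let above k := [set y | [forall l, (l != k) ==> (r l (m l) < r l y)]].
Let top k := [set x in above k | [forall y in above k, r k y <= r k x]].

Let aboveP k y : reflect (forall l, l != k -> r l (m l) < r l y) (y \in above k).
Proof. by rewrite inE; exact: (iffP forall_inP). Qed.

Let le_m k x : x \in above k -> r k x <= r k (m k).
Proof.
move=> /aboveP xa; have /dominatingP /(_ x) [l Hl] := dom_d.
have [->//|nlk] := eqVneq k l; first exact: Hl.
by have := xa l; rewrite eq_sym nlk ltnNge Hl //= => /(_ isT).
Qed.

Let onto x : x \in d -> exists k, m k = x.
Proof.
move=> xd; have /dominatingP /(_ x) [k Hk] := dom_d; exists k.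
by apply: (@r_inj k); apply/eqP; rewrite eqn_leq m_min //= Hk.
Qed.

(** Each element of [d] is some [m k], and dropping one of two indices with equal image loses
    nothing. As [d] has [n - 1] elements, [m] is injective on the remaining indices, so [i] and [j]
    are its only collision. *)
Let imset_setC1 k : (k == i) || (k == j) -> m @: [set~ k] = d.
Proof.
move=> kij; apply/eqP; rewrite eqEsubset; apply/andP; split.
  by apply/subsetP => _ /imsetP[l _ ->].
apply/subsetP => x xd; have [l mlx] := onto xd.
have [lk|nlk] := eqVneq l k; last first.
  by apply/imsetP; exists l => //; rewrite !inE.
case/orP: kij => /eqP kE; apply/imsetP.
  by exists j; rewrite ?inE ?kE 1?eq_sym // -mlx lk kE m_ij.
by exists i; rewrite ?inE ?kE // -mlx lk kE m_ij.
Qed.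

Let inj_setC1 k : (k == i) || (k == j) -> {in [set~ k] &, injective m}.
Proof.
move=> kij; apply/imset_injP; rewrite imset_setC1 //.
by rewrite cardsC1 card_ord -card_d.
Qed.

Let collide k l : k != l -> m k = m l -> (k == i) || (k == j).
Proof.
move=> nkl mkl; case: (eqVneq k i) => //= nki; case: (eqVneq k j) => // nkj.
have [li|nli] := eqVneq l i.
  have := @inj_setC1 j; rewrite eqxx orbT => /(_ isT k l).
  by rewrite !inE nkj li neq_ij mkl li => /(_ isT isT erefl) kE; rewrite kE eqxx in nki.
have := @inj_setC1 i; rewrite eqxx => /(_ isT k l).
by rewrite !inE nki nli mkl => /(_ isT isT erefl) kE; rewrite kE eqxx in nkl.
Qed.

Let other k : (k == i) || (k == j) -> exists2 l, l != k & m l = m k.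
Proof.
case/orP=> /eqP->; first by exists j; rewrite // eq_sym.
by exists i.
Qed.

Let top_notin k x : (k == i) || (k == j) -> x \in top k -> x \notin d.
Proof.
move=> kij; rewrite inE => /andP[xa _]; apply/negP => xd.
have xE : x = m k.
  by apply: (@r_inj k); apply/eqP; rewrite eqn_leq m_min // andbT le_m.
have [l nlk ml] := other kij.
by move/aboveP: xa => /(_ l nlk); rewrite xE -ml ltnn.
Qed.

Let top_dom k x : x \in top k -> dominating (x |: d).
Proof.
rewrite inE => /andP[xa /forall_inP xmax]; apply/dominatingP => y.
have [ya|] := boolP (y \in above k).
  exists k => u; rewrite !inE => /orP[/eqP->|ud]; first exact: xmax.
  exact: leq_trans (le_m ya) (m_min _ ud).
rewrite inE negb_forall => /existsP[l]; rewrite negb_imply -leqNgt => /andP[nlk ly].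
exists l => u; rewrite !inE => /orP[/eqP->|ud].
  by apply: (leq_trans ly); apply: ltnW; move/aboveP: xa => /(_ l nlk).
exact: leq_trans ly (m_min _ ud).
Qed.

Let dom_top x : x \notin d -> dominating (x |: d) ->
  exists2 k, (k == i) || (k == j) & x \in top k.
Proof.
move=> xd /dominatingP dom_x.
(* [K] collects the orders in which [x] undercuts [d]. Each element of [d] must stay minimal in an
   order outside [K], so [K] has at most one member; dominance at [x] supplies one. *)
pose K := [set k | r k x <= r k (m k)].
have sub_d : d \subset m @: ~: K.
  apply/subsetP => y yd; have [l Hl] := dom_x y; apply/imsetP; exists l.
    rewrite !inE -ltnNge ltn_neqAle; apply/andP; split.
      apply/negP => /eqP E; have := Hl x; rewrite !inE eqxx /= => /(_ isT).
      have yx : y != x by apply: contraNneq xd => <-.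
      have : r l y = r l (m l).
        by apply/eqP; rewrite eqn_leq m_min // Hl // !inE m_in orbT.
      by move=> /r_inj yE _; move/r_inj: E => E; rewrite yE E eqxx in yx.
    apply: leq_trans (m_min _ yd) _; by apply: Hl; rewrite !inE eqxx.
  by apply: (@r_inj l); apply/eqP; rewrite eqn_leq m_min // Hl ?andbT // !inE m_in orbT.
have := leq_trans (subset_leq_card sub_d) (leq_imset_card _ _).
have cK : #|K| + #|~: K| = n by rewrite cardsC card_ord.
move=> le_d.
have K1 : #|K| <= 1 by rewrite -(leq_add2r #|~: K|) cK add1n -[leqLHS]card_d ltnS.
have [k Hk] := dom_x x.
have kK : k \in K by rewrite inE; apply: Hk; rewrite !inE m_in orbT.
have KE l : l != k -> l \notin K.
  move=> nlk; apply: contraL K1 => lK; rewrite -ltnNge.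
  have <- : #|[set l; k]| = 2 by rewrite cards2 nlk.
  apply: subset_leq_card; apply/subsetP => u; rewrite !inE => /orP[] /eqP->.
    by rewrite inE in lK.
  by rewrite inE in kK.
exists k; last first.
  rewrite inE; apply/andP; split.
    by apply/aboveP => l /KE; rewrite inE -ltnNge.
  apply/forall_inP => y /aboveP ya; have [l Hl] := dom_x y.
  have [lk|nlk] := eqVneq l k; first by rewrite -lk; apply: Hl; rewrite !inE eqxx.
  by have := ya l nlk; rewrite ltnNge Hl // !inE m_in orbT.
(* [m k] is also minimal in an order outside [K], so [k] takes part in the collision. *)
have /imsetP[l] := subsetP sub_d _ (m_in k).
rewrite inE => lK mkl; apply: (@collide k l) => //.
by apply: contraNneq lK => <-.
Qed.

Let card_top k : #|top k| = (above k != set0).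
Proof.
case: eqVneq => [E|/set0Pn[x0 x0a]].
  apply/eqP; rewrite cards_eq0; apply/eqP/setP => x.
  by rewrite in_set0 inE E in_set0.
apply/eqP/cards1P.
case: (@arg_maxnP _ x0 (mem (above k)) (r k) x0a) => x xa xmax.
exists x; apply/setP => y; rewrite inE inE; apply/andP/eqP => [[ya /forall_inP ymax]|->].
  by apply: (@r_inj k); apply/eqP; rewrite eqn_leq ymax // andbT; exact: xmax.
by split=> //; apply/forall_inP => u ua; exact: xmax.
Qed.

(* Since [m] has a single collision [m i = m j], an element can be added to [d] only by making
   it the new minimum of order [i] or of order [j], where it is then determined. *)
Lemma card_cells :
  #|[set s | [&& dominating s, #|s| == n & d \subset s]]|
  = (above i != set0) + (above j != set0).
Proof.
rewrite -!card_top.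
have dis : top i :&: top j = set0.
  apply/setP => x; rewrite !in_set0; apply/negP; rewrite inE => /andP[].
  rewrite inE => /andP[xi _]; rewrite inE => /andP[/aboveP xj _].
  by have := xj i neq_ij; rewrite ltnNge le_m.
rewrite -cardsUI dis cards0 addn0.
rewrite -(@card_in_imset _ _ (fun x => x |: d)) => [|x y].
  apply: eq_card => s; rewrite inE; apply/and3P/imsetP.
    case=> dom_s /eqP card_s sub_ds.
    have /eqP/cards1P[x sE] : #|s :\: d| = 1.
      by rewrite cardsD (setIidPr sub_ds) card_s -card_d subSnn.
    have /setDP[xs xd] : x \in s :\: d by rewrite sE inE.
    have sx : s = x |: d by rewrite -sE setUC -{1}(setID s d) (setIidPr sub_ds).
    exists x => //; rewrite sx in dom_s.
    by have [k /orP[] /eqP-> kx] := dom_top xd dom_s; rewrite inE kx ?orbT.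
  case=> x; rewrite inE => xt ->.
  have [k kij xk] : exists2 k, (k == i) || (k == j) & x \in top k.
    by case/orP: xt => xt; [exists i|exists j]; rewrite ?eqxx ?orbT.
  split; [exact: top_dom xk| |exact: subsetUr].
  by rewrite cardsU1 (top_notin kij xk) add1n card_d.
move=> xt _ E.
have : x \in y |: d by rewrite -E in_setU1 eqxx.
rewrite in_setU1 => /orP[/eqP//|]; apply: contraTeq => _.
case/setUP: xt => xt; first by apply: (@top_notin i) xt; rewrite eqxx.
by apply: (@top_notin j) xt; rewrite eqxx orbT.
Qed.

End Pivot.

(* [z i] is the slack vertex of order [i]: below everything in order [i] and above all genuine
   vertices in the other orders. *)
Variables (z : 'I_n -> T) (c : T -> 'I_n) (x0 : T).
Hypothesis z_min : forall i y, r i (z i) <= r i y.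
Hypothesis z_max : forall i j x,
  j != i -> (forall k, x != z k) -> r i x < r i (z j).
Hypothesis cz : forall i, c (z i) = i.
Hypothesis x0_nz : forall i, x0 != z i.

Lemma argmin_in (d : {set T}) :
  d != set0 -> exists m : 'I_n -> T,
    (forall k, m k \in d) /\ (forall k x, x \in d -> r k (m k) <= r k x).
Proof.
case/set0Pn=> y yd; exists (fun k => [arg min_(x < y in d) r k x]).
by split=> k; case: arg_minnP.
Qed.

Definition door (o : 'I_n) (d : {set T}) :=
  [&& dominating d, c @: d == [set~ o] & #|d|.+1 == n].

(** The facet spanned by slack vertices alone; it plays the role of the boundary door in Sperner's
    lemma. *)
Definition base (o : 'I_n) := z @: [set~ o].

(** [card_cells] counts the nonempty sides of a door. For [base o] the collision is between [o] and
    some [j]: side [o] contains [x0], side [j] is empty. Any other door has a genuine vertex, which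
    puts [z k] into [above k] for every [k], so both sides are nonempty. *)
Lemma odd_card_cells (o : 'I_n) (d : {set T}) :
  1 < n -> door o d ->
  odd #|[set s | [&& dominating s, #|s| == n & d \subset s]]| = (d == base o).
Proof.
move=> n_gt1 /and3P[dom_d /eqP cd /eqP card_d].
have z_inj : injective z by apply: can_inj cz.
have d_n0 : d != set0 by rewrite -card_gt0 -ltnS card_d.
have [m [m_in m_min]] := argmin_in d_n0.
have [dE|nd] := eqVneq d (base o).
  have mE l : l != o -> m l = z l.
    move=> nlo; apply: (@r_inj l); apply/eqP; rewrite eqn_leq z_min andbT.
    by apply: m_min; rewrite dE; apply: imset_f; rewrite !inE.
  have [j jo moj] : exists2 j, j != o & m o = z j.
    by have := m_in o; rewrite {1}dE => /imsetP[j]; rewrite !inE; exists j.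
  have noj : o != j by rewrite eq_sym.
  have mE' : m o = m j by rewrite (mE j).
  rewrite (@card_cells _ m o j) //.
  set A := (X in nat_of_bool (X != set0) + _); set B := (X in _ + nat_of_bool (X != set0)).
  have -> : A != set0.
    apply/set0Pn; exists x0; rewrite inE; apply/forall_inP => l nlo.
    rewrite mE // ltn_neqAle z_min andbT; apply/negP => /eqP/r_inj E.
    by have := x0_nz l; rewrite E eqxx.
  have -> : B = set0; last by rewrite eqxx.
  apply/setP => y; rewrite in_set0 inE; apply/negbTE/negP => /forall_inP Hy.
  have := Hy o; rewrite eq_sym jo moj => /(_ isT) yo.
  have [k /eqP yk|nz] := pickP (fun k => y == z k); last first.
    have := z_max jo (fun k => negbT (nz k)).
    by rewrite ltnNge (ltnW yo).
  have [kj|nkj] := eqVneq k j; first by rewrite yk kj ltnn in yo.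
  have [ko|nko] := eqVneq k o; first by rewrite yk ko ltnNge z_min in yo.
  by have := Hy k nkj; rewrite mE // yk ltnn.
(* A door made only of slack vertices is determined by its colours, hence equals [base o]. *)
have [x xd xnz] : exists2 x, x \in d & forall k, x != z k.
  have [x /andP[xd /forallP xnz]|H] :=
    pickP (fun x => (x \in d) && [forall k, x != z k]); first by exists x.
  case/eqP: nd; apply/eqP; rewrite eqEcard card_imset //; apply/andP; split.
    apply/subsetP => x xd; have := H x; rewrite xd /= => /negbT.
    rewrite negb_forall => /existsP[k]; rewrite negbK => /eqP xk.
    by apply/imsetP; exists k => //; rewrite -cd -[k]cz -xk imset_f.
  by rewrite cardsC1 card_ord -card_d.
have /injectivePn[i [j nij mij]] : ~~ injectiveb m.
  apply/negP => /injectiveP m_inj.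
  have : m @: setT \subset d by apply/subsetP => _ /imsetP[k _ ->].
  move/subset_leq_card; rewrite card_imset // cardsT card_ord -ltnS card_d.
  by rewrite ltnn.
rewrite (@card_cells _ m i j) //.
have nz k : [set y | [forall l, (l != k) ==> (r l (m l) < r l y)]] != set0.
  apply/set0Pn; exists (z k); rewrite inE; apply/forall_inP => l nlk.
  by apply: leq_ltn_trans (m_min _ _ xd) (z_max _ xnz); rewrite eq_sym.
by rewrite !nz.
Qed.

(** If a non-rainbow cell has a door [s :\ x], the colour of [x] is repeated by exactly one other
    vertex [x'], and the doors are [s :\ x] and [s :\ x']. So there are none or two. *)
Lemma even_card_doors (o : 'I_n) (s : {set T}) :
  dominating s -> #|s| = n -> c @: s != setT ->
  ~~ odd #|[set d | door o d && (d \subset s)]|.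
Proof.
move=> dom_s card_s not_rainbow.
have [->|/set0Pn[d]] := eqVneq [set d | door o d && (d \subset s)] set0.
  by rewrite cards0.
rewrite inE => /andP[/and3P[dom_d /eqP cd /eqP card_d] sub_ds].
have /eqP/cards1P[x sE] : #|s :\: d| = 1.
  by rewrite cardsD (setIidPr sub_ds) card_s -card_d subSnn.
have /setDP[xs xd] : x \in s :\: d by rewrite sE inE.
have sx : s = x |: d by rewrite -sE setUC -{1}(setID s d) (setIidPr sub_ds).
have c_inj : {in d &, injective c}.
  by apply/imset_injP; rewrite cd cardsC1 card_ord -card_d.
have /imsetP[x' x'd cx] : c x \in c @: d.
  rewrite cd !inE; apply: contraNneq not_rainbow => cxo.
  by rewrite sx imsetU1 cd cxo setUCr.
have nxx' : x' != x by apply: contraNneq xd => <-.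
have x's : x' \in s by apply: subsetP x'd.
have cdx' : c @: (s :\ x') = c @: d.
  apply/eqP; rewrite eqEsubset; apply/andP; split; apply/subsetP => u /imsetP[y].
    rewrite sx !inE => /andP[_ /orP[/eqP->|yd]] ->; last exact: imset_f.
    by rewrite cx imset_f.
  move=> yd ->; have [->|nyx'] := eqVneq y x'.
    by rewrite -cx imset_f // !inE eq_sym nxx' xs.
  by rewrite imset_f // !inE nyx' (subsetP sub_ds).
have -> : [set d | door o d && (d \subset s)] = [set s :\ x; s :\ x'].
  apply/setP => e; rewrite in_set2 inE; apply/andP/idP.
    case=> /and3P[_ /eqP ce /eqP card_e] sub_es.
    have /eqP/cards1P[y yE] : #|s :\: e| = 1.
      by rewrite cardsD (setIidPr sub_es) card_s -card_e subSnn.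
    have eE : e = s :\ y.
      by rewrite -yE setDDr setDv set0U (setIidPr sub_es).
    have /setDP[ys ye] : y \in s :\: e by rewrite yE inE.
    have [yx|nyx] := eqVneq y x; first by rewrite eE yx eqxx.
    have [yx'|nyx'] := eqVneq y x'; first by rewrite eE yx' eqxx orbT.
    have e_inj : {in e &, injective c}.
      by apply/imset_injP; rewrite ce cardsC1 card_ord -card_e.
    have := e_inj x x'; rewrite eE !inE xs x's ![_ == y]eq_sym nyx nyx' cx.
    by move=> /(_ isT isT erefl) E; rewrite E eqxx in nxx'.
  case/orP=> /eqP->; rewrite subD1set; split=> //; apply/and3P; split.
  - exact: dominating_sub (subD1set _ _) dom_s.
  - have -> : s :\ x = d by rewrite sx setU1K.
    by rewrite cd.
  - by rewrite -card_s (cardsD1 x s) xs.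
  - exact: dominating_sub (subD1set _ _) dom_s.
  - by rewrite cdx' cd.
  - by rewrite -card_s (cardsD1 x' s) x's.
rewrite cards2; case: eqP => // /setP /(_ x').
by rewrite !inE eqxx x's nxx'.
Qed.

(* Sperner parity: count incident door-cell pairs in two ways; the door [base o] is the only one
   lying in an odd number of cells. *)
Lemma rainbow_dominating :
  1 < n -> exists2 s : {set T}, dominating s & c @: s = setT.
Proof.
move=> n_gt1; pose o : 'I_n := Ordinal (ltnW n_gt1).
have [s /and3P[dom_s _ /eqP cs]|none] :=
  pickP (fun s : {set T} => [&& dominating s, #|s| == n & c @: s == setT]).
  by exists s.
have z_inj : injective z by apply: can_inj cz.
have base_door : door o (base o).
  apply/and3P; split.
  - apply/dominatingP => y.
    have [k /eqP yk|nz] := pickP (fun k => y == z k).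
      by exists k => u _; rewrite yk z_min.
    exists o => _ /imsetP[k nko ->]; apply: ltnW; apply: z_max.
      by rewrite !inE in nko.
    by move=> k'; rewrite nz.
  - by rewrite -imset_comp (eq_imset _ (g := id)) ?imset_id.
  - by rewrite card_imset // cardsC1 card_ord prednK // ltnW.
have : \sum_(d | door o d) #|[set s | [&& dominating s, #|s| == n & d \subset s]]|
     = \sum_(s | dominating s && (#|s| == n)) #|[set d | door o d && (d \subset s)]|.
  under eq_bigr => d _ do rewrite -sum1_card.
  under [RHS]eq_bigr => s _ do rewrite -sum1_card.
  rewrite (exchange_big_dep (fun s => dominating s && (#|s| == n))) /=; last first.
    by move=> d s _; rewrite inE => /and3P[-> ->].
  by apply: eq_bigr => s /andP[ds cs]; apply: eq_bigl => d; rewrite !inE ds cs.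
move/(congr1 odd); rewrite !(big_morph odd oddD (erefl (odd 0))).
rewrite [RHS]big1 => [|s /andP[ds /eqP cs]]; last first.
  apply: negbTE; apply: even_card_doors => //.
  by have := none s; rewrite ds cs eqxx /= => ->.
rewrite (bigD1 (base o)) //= (odd_card_cells n_gt1 base_door) eqxx big1 // => d /andP[dd nd].
by rewrite (odd_card_cells n_gt1 dd) (negbTE nd).
Qed.

End Dominating.

(** Ties in [r i] are broken by [enum_rank], and the slack vertices are adjoined as a second
    summand, coloured by their own index. The set [S] is the genuine part of a rainbow dominating
    set. *)
Lemma scarf (X : finType) n (r : 'I_n -> X -> nat) (c : X -> 'I_n) (x0 : X) :
  1 < n -> exists S : {set X},
    forall y, exists2 i, i \in c @: S & forall x, x \in S -> r i y <= r i x.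
Proof.
move=> n_gt1.
pose top i := (\max_x r i x).+1 * #|X| + 1.
(* Genuine ranks are shifted by one, leaving 0 to the slack vertex of order [i]; the other slack
   vertices lie above [top i]. *)
pose rk i (t : X + 'I_n) := match t with
  | inl x => (r i x * #|X| + enum_rank x).+1
  | inr j => if j == i then 0 else top i + j end.
pose col (t : X + 'I_n) := match t with inl x => c x | inr j => j end.
have rk_top i x j : rk i (inl x) < top i + j.
  rewrite /rk /top addn1 addSn ltnS; apply: leq_trans (leq_addr _ _).
  apply: (@leq_trans ((r i x).+1 * #|X|)).
    by rewrite mulSn addnC -addSn leq_add2r.
  by rewrite leq_mul2r ltnS (leq_bigmax (F := r i)) orbT.
have rk_inj i : injective (rk i).
  move=> [x|j] [y|k] /=.
  - move=> [] E; have cX : 0 < #|X| by apply/card_gt0P; exists x.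
    have /(congr1 (modn^~ #|X|)) := E.
    rewrite !modnMDl !modn_small ?ltn_ord // => H.
    by congr inl; apply: enum_rank_inj; apply: val_inj.
  - by case: ifP => // _ E; have := rk_top i x k; rewrite -E ltnn.
  - by case: ifP => // _ E; have := rk_top i y j; rewrite E ltnn.
  - case: eqP => [->|_]; case: eqP => [->|_] //.
    + by rewrite /top addn1.
    + by rewrite /top addn1.
    + by move/addnI => E; congr inr; apply: val_inj.
have z_min i y : rk i (inr i) <= rk i y by rewrite /= eqxx.
have z_max (i j : 'I_n) t : j != i -> (forall k, t != inr k) -> rk i t < rk i (inr j).
  case: t => [x|k] ji H; last by have := H k; rewrite eqxx.
  by rewrite [ltnRHS]/= (negbTE ji); exact: rk_top.
have [||s /dominatingP dom_s cs] :=
  @rainbow_dominating _ n rk rk_inj inr col (inl x0) z_min z_max _ _ n_gt1; [by []|by []|].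
exists [set x | inl x \in s] => y; have [i Hi] := dom_s (inl y).
exists i => [|x].
  (* Colour [i] cannot come from the slack vertex of [i], whose rank 0 is below that of [y]; so it
     comes from a genuine vertex. *)
  have /imsetP[[x|j] us iE] : i \in col @: s by rewrite cs inE.
    by rewrite iE; apply: (imset_f c); rewrite inE.
  by have := Hi _ us; rewrite iE /= eqxx.
rewrite inE => xs; have := Hi _ xs; rewrite /rk ltnS => E.
rewrite leqNgt; apply: contraL E => lt; rewrite -ltnNge.
apply: (@leq_trans ((r i x).+1 * #|X|)).
  by rewrite mulSn addnC ltn_add2r.
by apply: leq_trans (leq_addr _ _); rewrite leq_mul2r lt orbT.
Qed.

Lemma list_sum_bigop n (x : nat -> nat) :
  List.list_sum (List.map x (List.seq 0 n)) = \sum_(i < n) x i.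
Proof.
elim: n => [|n IH]; first by rewrite big_ord0.
by rewrite List.seq_S List.map_app List.list_sum_app IH big_ord_recr /= !plusE addn0.
Qed.

(* A dominating set on the colours [C] has nearly maximal coordinate minima: were their sum at
   most [D - #|C|], some grid point would exceed all of them. *)
Lemma grid_scarf n D (P : (nat -> nat) -> nat -> Prop) :
  (2 <= n)%coq_nat ->
  (forall x, List.list_sum (List.map x (List.seq 0 n)) = D ->
     exists i, (i < n)%coq_nat /\ P x i) ->
  exists x, List.list_sum (List.map x (List.seq 0 n)) = D /\
    forall i, (i < n)%coq_nat -> (0 < x i)%coq_nat ->
      exists y, P y i /\
        forall j, (j < n)%coq_nat ->
          (y j <= x j + n)%coq_nat /\ (x j <= y j + n)%coq_nat.
Proof.
move=> /leP n_gt1 HP.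
(* Extension by 0 beyond [n], to pass from ordinals to [nat]. *)
pose fn (g : 'I_n -> nat) j := oapp g 0 (insub j).
have fnE g (i : 'I_n) : fn g i = g i by rewrite /fn valK.
have fn_sum g : List.list_sum (List.map (fn g) (List.seq 0 n)) = \sum_i g i.
  by rewrite list_sum_bigop; apply: eq_bigr => i _; rewrite fnE.
pose X : finType := {f : {ffun 'I_n -> 'I_D.+1} | \sum_i f i == D :> nat}.
pose v (x : X) (i : 'I_n) : nat := val x i.
have v_sum x : \sum_i v x i = D by apply/eqP; exact: (valP x).
have mkX (g : 'I_n -> nat) : \sum_i g i = D -> exists x : X, v x =1 g.
  move=> gD.
  have g_lt i : g i < D.+1 by rewrite ltnS -gD (bigD1 i) //= leq_addr.
  have fD : \sum_i [ffun i => Ordinal (g_lt i)] i == D :> nat.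
    by apply/eqP; rewrite -[RHS]gD; apply: eq_bigr => i _; rewrite ffunE.
  exists (exist (fun f : {ffun 'I_n -> 'I_D.+1} => \sum_i f i == D :> nat) _ fD) => i.
  by rewrite /v /= ffunE.
have /fin_all_exists[c cP] (x : X) : exists i : 'I_n, P (fn (v x)) i.
  have [|i [/ltP i_lt Pi]] := HP (fn (v x)); first by rewrite fn_sum v_sum.
  by exists (Ordinal i_lt).
pose o : 'I_n := Ordinal (ltnW n_gt1).
have [x0 _] : exists x : X, v x =1 (fun i => (i == o) * D).
  by apply: mkX; rewrite (bigD1 o) // eqxx mul1n big1 => [|i /negbTE-> //]; exact: addn0.
have [S HS] := scarf (fun i x => v x i) c x0 n_gt1.
have [i1 i1C _] := HS x0; have /imsetP[s0 s0S _] := i1C.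
pose C := c @: S.
pose m i := v [arg min_(x < s0 in S) v x i] i.
have m_le i x : x \in S -> m i <= v x i.
  by rewrite /m; case: arg_minnP => // y _ ymin xS; exact: ymin.
have m_at i : exists2 x, x \in S & v x i = m i.
  by rewrite /m; case: arg_minnP => // y yS _; exists y.
have sum_bump k (g : 'I_n -> nat) : \sum_(i in C) g i + k =
    \sum_i (if i \in C then g i + (i == i1) * k else 0).
  rewrite -big_mkcond big_split /=; congr addn.
  rewrite (bigD1 i1) //= eqxx mul1n big1 ?addn0 // => i /andP[_ /negbTE->].
  by [].
have gap : D < \sum_(i in C) m i + #|C|.
  rewrite ltnNge; apply/negP => le_D.
  have sD : \sum_(i in C) (m i).+1 + (D - (\sum_(i in C) m i + #|C|)) = D.
    rewrite -[RHS](subnKC le_D); congr addn.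
    under eq_bigr do rewrite -addn1.
    by rewrite big_split /= sum1_card.
  have [y yE] := mkX _ (etrans (esym (sum_bump _ _)) sD).
  have [i iC Hi] := HS y; have [x xS xi] := m_at i.
  by have := Hi x xS; rewrite xi yE /= iC addSn ltnNge leq_addr.
have C_le : #|C| <= n by rewrite -[leqRHS]card_ord max_card.
have sum_le x : x \in S -> \sum_(i in C) m i <= D.
  move=> xS; rewrite -(v_sum x) [leqRHS](bigID (mem C)) /=.
  apply: leq_trans (leq_addr _ _); apply: leq_sum => i _; exact: m_le.
(* The coordinates of [x] sum to [D] and those in [C] are at least their minima, whose sum is within
   [n] of [D]; so no single coordinate has an excess above [n]. *)
have x_lt x j : x \in S -> v x j <= (if j \in C then m j else 0) + n.
  move=> xS; have := v_sum x; rewrite (bigD1 j) //= => vD.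
  have : \sum_(i in C | i != j) m i <= \sum_(i | i != j) v x i.
    rewrite big_mkcondl /=; apply: leq_sum => i _; case: ifP => // _; exact: m_le.
  move: gap; have [jC|njC] := boolP (j \in C).
    rewrite (bigD1 j jC) /= => gap le; rewrite -(leq_add2r (\sum_(i in C | i != j) m i)).
    apply: (@leq_trans D); first by rewrite -vD leq_add2l.
    by apply: ltnW (leq_trans gap _); rewrite addnAC leq_add2r leq_add2l.
  move=> gap le; rewrite -(leq_add2r (\sum_(i in C) m i)).
  have {}le : \sum_(i in C) m i <= \sum_(i | i != j) v x i.
    apply: leq_trans le; rewrite [leqRHS](eq_bigl (mem C)) // => i.
    by rewrite /=; have [->|_] := eqVneq i j; rewrite ?andbT //= (negbTE njC).
  apply: (@leq_trans D); first by rewrite -vD leq_add2l; exact: le.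
  by apply: ltnW (leq_trans gap _); rewrite add0n addnC leq_add2r.
(* The witness [w] takes the minima on [C] and puts the leftover [K] on one index of [C] to reach
   total [D]. Its support lies in [C], so each support index is the colour of some point of [S]. *)
pose K := D - \sum_(i in C) m i.
have K_le : K <= n.
  by rewrite leq_subLR; apply: ltnW (leq_trans gap _); rewrite leq_add2l.
pose w i := if i \in C then m i + (i == i1) * K else 0.
exists (fn w); split; first by rewrite fn_sum -sum_bump subnKC // (sum_le s0).
move=> i /ltP i_lt; rewrite (fnE w (Ordinal i_lt)) => /ltP.
rewrite {1}/w; case: ifP => // /imsetP[x xS iE] _.
exists (fn (v x)); split; first by have := cP x; rewrite -iE.
move=> j /ltP j_lt; rewrite (fnE w (Ordinal j_lt)) (fnE (v x) (Ordinal j_lt)).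
move: (Ordinal j_lt) => {j_lt} j; split; apply/leP; rewrite /w.
  apply: (leq_trans (x_lt _ j xS)); rewrite leq_add2r.
  by case: ifP => // _; exact: leq_addr.
case: ifP => // jC; apply: leq_add; first exact: m_le.
by case: eqP; rewrite ?mul1n.
Qed.

End Scarf.

(** * Finite sums *)

Definition lsum {A} (l : list A) (f : A -> R) : R := fold_right Rplus 0 (map f l).

Section ListSums.
Context {A B : Type}.
Implicit Types (l : list A) (f g : A -> R).

Lemma lsum_ext l f g : (forall x, In x l -> f x = g x) -> lsum l f = lsum l g.
Proof.
  unfold lsum; induction l as [|a l IH]; simpl; intros H; [reflexivity|].
  rewrite (H a), IH; auto.
Qed.

Lemma lsum_le l f g : (forall x, In x l -> f x <= g x) -> lsum l f <= lsum l g.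
Proof.
  unfold lsum; induction l as [|a l IH]; simpl; intros H; [lra|].
  apply Rplus_le_compat; auto.
Qed.

Lemma lsum_plus l f g : lsum l (fun x => f x + g x) = lsum l f + lsum l g.
Proof. unfold lsum; induction l as [|a l IH]; simpl; [|rewrite IH]; lra. Qed.

Lemma lsum_scal l c f : lsum l (fun x => c * f x) = c * lsum l f.
Proof. unfold lsum; induction l as [|a l IH]; simpl; [|rewrite IH]; lra. Qed.

Lemma lsum_minus l f g : lsum l (fun x => f x - g x) = lsum l f - lsum l g.
Proof. unfold lsum; induction l as [|a l IH]; simpl; [|rewrite IH]; lra. Qed.

Lemma lsum_const l c : lsum l (fun _ => c) = INR (length l) * c.
Proof.
  unfold lsum; induction l as [|a l IH]; [simpl; lra|].
  simpl map; simpl fold_right; rewrite IH; simpl length; rewrite S_INR; lra.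
Qed.

Lemma lsum_app l1 l2 f : lsum (l1 ++ l2) f = lsum l1 f + lsum l2 f.
Proof. unfold lsum; induction l1 as [|a l IH]; simpl; [|rewrite IH]; lra. Qed.

Lemma lsum_map (l : list B) (h : B -> A) f : lsum (map h l) f = lsum l (fun x => f (h x)).
Proof. unfold lsum; rewrite map_map; reflexivity. Qed.

Lemma lsum_ge0 l f : (forall x, In x l -> 0 <= f x) -> 0 <= lsum l f.
Proof.
  intros H; rewrite <- (Rmult_0_r (INR (length l))), <- lsum_const.
  apply lsum_le; exact H.
Qed.

Lemma lsum_term_le l f x :
  (forall y, In y l -> 0 <= f y) -> In x l -> f x <= lsum l f.
Proof.
  unfold lsum; induction l as [|a l IH]; simpl; intros H Hx; [tauto|].
  assert (0 <= fold_right Rplus 0 (map f l)) by (apply (lsum_ge0 l); auto).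
  assert (0 <= f a) by auto.
  destruct Hx as [->|Hx]; [lra|].
  specialize (IH (fun y Hy => H y (or_intror Hy)) Hx); lra.
Qed.

Lemma lsum_abs l f : Rabs (lsum l f) <= lsum l (fun x => Rabs (f x)).
Proof.
  unfold lsum; induction l as [|a l IH]; simpl; [rewrite Rabs_R0; lra|].
  eapply Rle_trans; [apply Rabs_triang|]; lra.
Qed.

End ListSums.

Lemma lsum_swap {A B} (l : list A) (l' : list B) (f : A -> B -> R) :
  lsum l (fun x => lsum l' (f x)) = lsum l' (fun y => lsum l (fun x => f x y)).
Proof.
  induction l as [|a l IH].
  - change (0 = lsum l' (fun _ => 0)); rewrite lsum_const; lra.
  - change (lsum l' (f a) + lsum l (fun x => lsum l' (f x))
      = lsum l' (fun y => f a y + lsum l (fun x => f x y))).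
    rewrite IH, lsum_plus; reflexivity.
Qed.

Lemma sumR_lsum n f : sumR n f = lsum (seq 0 n) f.
Proof. reflexivity. Qed.

Lemma in_range i n : In i (seq 0 n) -> (i < n)%nat.
Proof. rewrite in_seq; lia. Qed.

Lemma range_in i n : (i < n)%nat -> In i (seq 0 n).
Proof. rewrite in_seq; lia. Qed.

Lemma sumR_ext n f g : (forall i, (i < n)%nat -> f i = g i) -> sumR n f = sumR n g.
Proof. intros H; apply lsum_ext; intros i Hi; apply H, in_range, Hi. Qed.

Lemma sumR_le n f g : (forall i, (i < n)%nat -> f i <= g i) -> sumR n f <= sumR n g.
Proof. intros H; apply lsum_le; intros i Hi; apply H, in_range, Hi. Qed.

Lemma sumR_ge0 n f : (forall i, (i < n)%nat -> 0 <= f i) -> 0 <= sumR n f.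
Proof. intros H; apply lsum_ge0; intros i Hi; apply H, in_range, Hi. Qed.

Lemma sumR_term_le n f i :
  (forall i, (i < n)%nat -> 0 <= f i) -> (i < n)%nat -> f i <= sumR n f.
Proof.
  intros H Hi; apply (lsum_term_le (seq 0 n) f); [|apply range_in, Hi].
  intros j Hj; apply H, in_range, Hj.
Qed.

Lemma sumR_plus n f g : sumR n (fun i => f i + g i) = sumR n f + sumR n g.
Proof. apply lsum_plus. Qed.

Lemma sumR_minus n f g : sumR n (fun i => f i - g i) = sumR n f - sumR n g.
Proof. apply lsum_minus. Qed.

Lemma sumR_scal n c f : sumR n (fun i => c * f i) = c * sumR n f.
Proof. apply lsum_scal. Qed.

Lemma sumR_const n c : sumR n (fun _ => c) = INR n * c.
Proof. unfold sumR; fold (lsum (seq 0 n) (fun _ => c)); rewrite lsum_const, length_seq; reflexivity. Qed.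

Lemma sumR_abs n f : Rabs (sumR n f) <= sumR n (fun i => Rabs (f i)).
Proof. apply lsum_abs. Qed.

Lemma sumR_S n f : sumR (S n) f = sumR n f + f n.
Proof.
  rewrite !sumR_lsum, seq_S, lsum_app; unfold lsum at 2; simpl; lra.
Qed.

Lemma sumR_shift n k f : sumR (n + k) f = sumR n f + sumR k (fun i => f (n + i)%nat).
Proof.
  induction k as [|k IH].
  - rewrite Nat.add_0_r; unfold sumR at 3; simpl; lra.
  - rewrite Nat.add_succ_r, !sumR_S, IH; lra.
Qed.

Lemma sumR_swap n k (f : nat -> nat -> R) :
  sumR n (fun i => sumR k (f i)) = sumR k (fun j => sumR n (fun i => f i j)).
Proof. apply lsum_swap. Qed.

Lemma sumR_single n k c : (k < n)%nat ->
  sumR n (fun i => if Nat.eq_dec i k then c i else 0) = c k.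
Proof.
  induction n as [|n IH]; intros Hk; [lia|].
  rewrite sumR_S; destruct (Nat.eq_dec n k) as [->|Hn].
  - rewrite (sumR_ext _ _ (fun _ => 0)), sumR_const; [lra|].
    intros i Hi; destruct (Nat.eq_dec i k); [lia|reflexivity].
  - rewrite IH by lia; lra.
Qed.

Lemma exp_le_compat x y : x <= y -> exp x <= exp y.
Proof. intros [H| ->]; [left; apply exp_increasing, H|right; reflexivity]. Qed.

(** * Simultaneous deviation bounds *)

(** The linear term vanishes in the mean of a centred variable. Up to [1 / 2], [exp y] is at most
    [1 / (1 - y)], hence at most [1 + y + 2 * y ^ 2]; beyond, [y <= 2 * y ^ 2]. *)
Lemma exp_le_quad y : exp y <= y + exp (2 * y ^ 2).
Proof.
  pose proof (exp_ineq1_le (2 * y ^ 2)); pose proof (exp_pos y).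
  destruct (Rle_dec y (1 / 2)) as [H1|H1].
  - assert (exp y * (1 - y) <= 1).
    { assert (E : exp y * exp (- y) = 1) by (rewrite <- exp_plus, Rplus_opp_r; apply exp_0).
      pose proof (exp_ineq1_le (- y)); nra. }
    assert (exp y <= 1 + y + 2 * y ^ 2); [|lra].
    assert (1 <= (1 + y + 2 * y ^ 2) * (1 - y)) by nra.
    apply Rmult_le_reg_r with (1 - y); lra.
  - assert (exp y <= exp (2 * y ^ 2)) by (apply exp_le_compat; nra); lra.
Qed.

(** Hoeffding's lemma, with constant 2 in place of [1 / 2]. *)
Lemma exp_moment n p X th w :
  is_strategy n p -> sumR n (fun o => p o * X o) = 0 ->
  (forall o, (o < n)%nat -> Rabs (X o) <= w) ->
  sumR n (fun o => p o * exp (th * X o)) <= exp (2 * th ^ 2 * w ^ 2).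
Proof.
  intros [H0 H1] HX Hw.
  apply Rle_trans with (sumR n (fun o => th * (p o * X o) + exp (2 * th ^ 2 * w ^ 2) * p o)).
  - apply sumR_le; intros o Ho; specialize (H0 o Ho); specialize (Hw o Ho).
    pose proof (exp_le_quad (th * X o)).
    assert (exp (2 * (th * X o) ^ 2) <= exp (2 * th ^ 2 * w ^ 2)).
    { apply exp_le_compat; rewrite Rpow_mult_distr.
      assert (X o ^ 2 <= w ^ 2).
      { rewrite <- (pow2_abs (X o)); apply pow_incr; split; [apply Rabs_pos|exact Hw]. }
      pose proof (pow2_ge_0 th); nra. }
    nra.
  - rewrite sumR_plus, !sumR_scal, HX, H1; lra.
Qed.

(** Asking for positive weight keeps the outcomes chosen later inside the support. *)
Lemma exists_le_mean n p v : is_strategy n p ->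
  exists o, (o < n)%nat /\ 0 < p o /\ v o <= sumR n (fun o => p o * v o).
Proof.
  intros [H0 H1]; set (M := sumR n (fun o => p o * v o)); apply NNPP; intros Hn.
  assert (Hgt : forall o, (o < n)%nat -> 0 < p o -> M < v o).
  { intros o Ho Hp; apply Rnot_le_lt; intros Hle; apply Hn; exists o; auto. }
  assert (Hz : sumR n (fun o => p o * (v o - M)) = 0).
  { rewrite (sumR_ext n _ (fun o => p o * v o - M * p o)) by (intros; lra).
    rewrite sumR_minus, sumR_scal, H1; unfold M; lra. }
  assert (Hnn : forall o, (o < n)%nat -> 0 <= p o * (v o - M)).
  { intros o Ho; destruct (H0 o Ho) as [Hp|<-]; [specialize (Hgt o Ho Hp); nra|lra]. }
  assert (forall o, (o < n)%nat -> p o = 0).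
  { intros o Ho; destruct (H0 o Ho) as [Hp|<-]; [|reflexivity].
    pose proof (sumR_term_le n _ o Hnn Ho) as Hle; simpl in Hle; rewrite Hz in Hle.
    specialize (Hgt o Ho Hp); nra. }
  rewrite (sumR_ext n p (fun _ => 0)), sumR_const in H1 by assumption; lra.
Qed.

(* Method of conditional expectations: the potential
   [sum_f g f * exp (th f * partial sum of X f)] never has to exceed its mean. *)
Lemma derandomize {F} (L : list F) d pi (X : F -> nat -> nat -> R) w th T : forall g,
  (forall f, In f L -> 0 <= g f) ->
  (forall s, (s < T)%nat -> is_strategy d (pi s)) ->
  (forall f s, In f L -> (s < T)%nat -> sumR d (fun o => pi s o * X f s o) = 0) ->
  (forall f s o, In f L -> (s < T)%nat -> (o < d)%nat -> Rabs (X f s o) <= w s) ->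
  exists o : nat -> nat, (forall s, (s < T)%nat -> (o s < d)%nat /\ 0 < pi s (o s)) /\
    lsum L (fun f => g f * exp (th f * sumR T (fun s => X f s (o s))))
    <= lsum L (fun f => g f * exp (2 * th f ^ 2 * sumR T (fun s => w s ^ 2))).
Proof.
  induction T as [|T IH]; intros g Hg Hpi HX Hw.
  - exists (fun _ => O); split; [lia|].
    apply Req_le, lsum_ext; intros f _; unfold sumR; simpl; rewrite !Rmult_0_r; reflexivity.
  (* The last round is first charged to the weights through its moment bound; its outcome is chosen
     after the earlier ones. *)
  - destruct (IH (fun f => g f * exp (2 * th f ^ 2 * w T ^ 2))) as [o [Ho Hle]].
    + intros f Hf; apply Rmult_le_pos; [auto|left; apply exp_pos].
    + auto.
    + auto.
    + auto.
    + set (h := fun f => g f * exp (th f * sumR T (fun s => X f s (o s)))).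
      destruct (exists_le_mean d (pi T) (fun k => lsum L (fun f => h f * exp (th f * X f T k))))
        as [k [Hk [Hpk Hkle]]]; [auto|].
      exists (fun s => if Nat.eq_dec s T then k else o s); split.
      { intros s Hs; destruct (Nat.eq_dec s T) as [->|]; [auto|apply Ho; lia]. }
      rewrite (lsum_ext L _ (fun f => h f * exp (th f * X f T k))).
      2:{ intros f _; unfold h; rewrite sumR_S.
          destruct (Nat.eq_dec T T) as [_|]; [|congruence].
          rewrite (sumR_ext T _ (fun s => X f s (o s))).
          - rewrite Rmult_plus_distr_l, exp_plus; lra.
          - intros s Hs; destruct (Nat.eq_dec s T); [lia|reflexivity]. }
      eapply Rle_trans; [exact Hkle|].
      rewrite (sumR_ext d _ (fun k => lsum L (fun f => h f * (pi T k * exp (th f * X f T k))))).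
      2:{ intros j _; rewrite <- lsum_scal; apply lsum_ext; intros f _; lra. }
      rewrite sumR_lsum, lsum_swap.
      eapply Rle_trans; [apply (lsum_le L _ (fun f => h f * exp (2 * th f ^ 2 * w T ^ 2)))|].
      { intros f Hf; rewrite lsum_scal; apply Rmult_le_compat_l.
        - apply Rmult_le_pos; [auto|left; apply exp_pos].
        - apply exp_moment; auto. }
      eapply Rle_trans; [|eapply Rle_trans; [exact Hle|]]; apply Req_le, lsum_ext; intros f _.
      * unfold h; lra.
      * rewrite sumR_S, Rmult_plus_distr_l, exp_plus; lra.
Qed.

(** Chernoff and union bound: [th = t / (4 * v)] minimises [2 * th ^ 2 * v - th * t], with value
    [- t ^ 2 / (8 * v)]. A single violated bound would already make the derandomized sum at least
    1. *)
Lemma simultaneous_deviation {F} (L : list F) d T pi (X : F -> nat -> nat -> R) w v t :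
  0 < v -> sumR T (fun s => w s ^ 2) <= v ->
  (forall s, (s < T)%nat -> is_strategy d (pi s)) ->
  (forall f s, In f L -> (s < T)%nat -> sumR d (fun o => pi s o * X f s o) = 0) ->
  (forall f s o, In f L -> (s < T)%nat -> (o < d)%nat -> Rabs (X f s o) <= w s) ->
  (forall f, In f L -> 0 <= t f) ->
  lsum L (fun f => exp (- (t f ^ 2 / (8 * v)))) < 1 ->
  exists o : nat -> nat, (forall s, (s < T)%nat -> (o s < d)%nat /\ 0 < pi s (o s)) /\
    forall f, In f L -> sumR T (fun s => X f s (o s)) < t f.
Proof.
  intros Hv Hwv Hpi HX Hw Ht Hlt.
  set (th := fun f => t f / (4 * v)).
  destruct (derandomize L d pi X w th T (fun f => exp (- (th f * t f)))) as [o [Ho Hle]]; auto.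
  { intros f _; left; apply exp_pos. }
  exists o; split; [exact Ho|]; intros f Hf; apply Rnot_le_lt; intros Hge.
  assert (H1 : 1 <= lsum L (fun f => exp (- (th f * t f)) * exp (th f * sumR T (fun s => X f s (o s))))).
  { eapply Rle_trans; [|apply (lsum_term_le L _ f); [|exact Hf]].
    - simpl; rewrite <- exp_plus, <- exp_0; apply exp_le_compat.
      assert (0 <= th f); [|nra].
      apply Rmult_le_pos; [auto|]; left; apply Rinv_0_lt_compat; lra.
    - intros; apply Rmult_le_pos; left; apply exp_pos. }
  assert (H2 : lsum L (fun f => exp (- (th f * t f)) * exp (2 * th f ^ 2 * sumR T (fun s => w s ^ 2)))
     <= lsum L (fun f => exp (- (t f ^ 2 / (8 * v))))).
  { apply lsum_le; intros h _; rewrite <- exp_plus; apply exp_le_compat.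
    replace (- (t h ^ 2 / (8 * v))) with (- (th h * t h) + 2 * th h ^ 2 * v).
    - pose proof (pow2_ge_0 (th h)); nra.
    - unfold th; field; lra. }
  lra.
Qed.

Lemma random_signs n w v (L : list ((nat -> R) * R)) :
  0 < v -> sumR n (fun s => w s ^ 2) <= v ->
  (forall a t, In (a, t) L -> 0 <= t /\ forall s, (s < n)%nat -> Rabs (a s) <= w s) ->
  lsum L (fun f => exp (- (snd f ^ 2 / (8 * v)))) < 1 ->
  exists s : nat -> R, (forall i, s i = 1 \/ s i = -1) /\
    forall a t, In (a, t) L -> sumR n (fun i => a i * s i) < t.
Proof.
  intros Hv Hw HL Hlt.
  destruct (simultaneous_deviation L 2 n (fun _ _ => / 2)
    (fun f s o => match o with O => fst f s | _ => - fst f s end) w v snd) as [o [_ Ho]]; auto.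
  - intros s _; split; [intros; lra|unfold sumR; simpl; lra].
  - intros f s _ _; unfold sumR; simpl; lra.
  - intros [a t] s k Hf Hs _; destruct (HL _ _ Hf) as [_ Ha].
    destruct k; simpl; [|rewrite Rabs_Ropp]; auto.
  - intros [a t] Hf; apply (HL _ _ Hf).
  - exists (fun i => match o i with O => 1 | _ => -1 end); split.
    + intros i; destruct (o i); auto.
    + intros a t Hf; specialize (Ho _ Hf); simpl in Ho.
      eapply Rle_lt_trans; [apply Req_le, sumR_ext|exact Ho].
      intros i _; simpl; destruct (o i); lra.
Qed.

(** * Sparse approximation of strategies *)

Definition light (p : vec) (x : R) : vec := fun i => if Rle_dec (p i) x then p i else 0.

Lemma light_bounds n p x i : is_strategy n p -> (i < n)%nat ->
  0 <= light p x i <= p i /\ light p x i ^ 2 <= x * light p x i.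
Proof.
  intros [H0 _] Hi; specialize (H0 i Hi); unfold light.
  destruct (Rle_dec (p i) x); split; try lra; nra.
Qed.

(** What stability yields when the opponent's strategy is fixed. [B] is the opponent's payoff
    matrix, with columns indexed by the strategies of [p]: shrinking the support keeps the replies
    of [p] good, and small payoff changes keep those of the opponent good. *)
Definition covered n (B : mat) (p : vec) (r Delta : R) (L : list vec) : Prop :=
  forall p', is_strategy n p' ->
    (forall i, (i < n)%nat -> 0 < p' i -> 0 < p i) ->
    (forall j, (j < n)%nat -> Rabs (row_pay n B j p' - row_pay n B j p) <= r) ->
    exists q, In q L /\ Defs.dist n p' q <= Delta.

(** [147968 = 32 * 68 ^ 2] gives each payoff event below the bound [/ INR n ^ 4]. *)
Definition granularity n eps Delta : R := 147968 * (Delta / eps) ^ 2 * ln (INR n).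

Lemma INR_ge2 n : (2 <= n)%nat -> 2 <= INR n.
Proof. intros H; apply le_INR in H; simpl in H; lra. Qed.

Lemma ln_INR_gt n : (2 <= n)%nat -> 1 / 2 < ln (INR n).
Proof.
  intros H; apply INR_ge2 in H; pose proof ln_lt_2.
  destruct H as [H|<-]; [|lra]; pose proof (ln_increasing 2 (INR n)); lra.
Qed.

Lemma ratio_sq_ge1 eps Delta : 0 < eps -> eps <= Delta -> 1 <= (Delta / eps) ^ 2.
Proof.
  intros H1 H2; assert (1 <= Delta / eps); [|nra].
  apply Rmult_le_reg_r with eps; [lra|]; unfold Rdiv; rewrite Rmult_assoc, Rinv_l; lra.
Qed.

Lemma exp_neg_nat_ln n k : (2 <= n)%nat -> exp (- (INR k * ln (INR n))) = / INR n ^ k.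
Proof.
  intros H; apply INR_ge2 in H.
  rewrite exp_Ropp; f_equal; fold (Rpower (INR n) (INR k)); apply Rpower_pow; lra.
Qed.

(* If the light part of [p] had mass at least [34 Delta], multiplying its entries by
   [1 +- 17 Delta / mass] with random signs and renormalising would almost preserve all
   payoffs, yet with positive probability it escapes every [Delta]-ball around [L]. *)
Lemma light_mass_lt n B p eps Delta L x :
  (2 <= n)%nat -> 0 < eps -> eps <= Delta -> entries01 n B -> is_strategy n p ->
  covered n B p (eps / 4) Delta L ->
  INR (length L) <= Rpower (INR n) ((Delta / eps) ^ 2) ->
  34 * Delta <= sumR n (light p x) ->
  sumR n (light p x) < x * granularity n eps Delta.
Proof.
  intros Hn He HeD HB Hp Hcov HL Hmu34; apply Rnot_le_lt; intros Hx.
  set (w := light p x) in *; set (mu := sumR n w) in *.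
  set (m := granularity n eps Delta) in *.
  assert (Hln := ln_INR_gt n Hn); assert (Hr := ratio_sq_ge1 eps Delta He HeD).
  assert (Hm : 0 < m) by (unfold m, granularity; nra).
  assert (Hmu : 0 < mu) by lra.
  assert (Hw : forall i, (i < n)%nat -> 0 <= w i <= p i) by (intros; eapply light_bounds; eauto).
  (* With [68 = 4 * 17], a deviation [tau * mu] scaled by [17 * Delta / mu] is [eps / 4]. *)
  set (tau := eps / (68 * Delta)); set (v := mu ^ 2 / m).
  assert (Htau : 0 < tau) by (apply Rdiv_lt_0_compat; lra).
  assert (Htau1 : tau <= / 68).
  { apply Rmult_le_reg_r with (68 * Delta); [lra|].
    unfold tau; field_simplify; lra. }
  assert (Hv : 0 < v) by (apply Rdiv_lt_0_compat; nra).
  (* Renormalisation subtracts from the signs their weighted mean, which in the payoffs amounts to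
     subtracting [cbar j] from [B j i]. *)
  set (cbar := fun j => sumR n (fun i => w i * B j i) / mu).
  assert (Hcmu : forall j, sumR n (fun i => w i * B j i) = cbar j * mu)
    by (intros; unfold cbar; field; lra).
  assert (Hcb : forall j, (j < n)%nat -> 0 <= cbar j <= 1).
  { intros j Hj.
    assert (0 <= sumR n (fun i => w i * B j i)).
    { apply sumR_ge0; intros i Hi; apply Rmult_le_pos; [apply Hw|apply HB]; auto. }
    assert (sumR n (fun i => w i * B j i) <= mu).
    { apply sumR_le; intros i Hi; specialize (Hw i Hi); destruct (HB j i Hj Hi); nra. }
    rewrite Hcmu in *; split; nra. }
  set (a := fun j i => w i * (B j i - cbar j)).
  (* The direction from [p] to [q]: signs that do not correlate with it move [p] away from [q]. *)
  set (sg := fun (q : vec) i => if Rle_dec 0 (q i - p i) then 1 else -1).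
  set (LL := [(w, tau * mu); (fun i => - w i, tau * mu)]
     ++ map (fun j => (a j, tau * mu)) (seq 0 n)
     ++ map (fun j => (fun i => - a j i, tau * mu)) (seq 0 n)
     ++ map (fun q => (fun i => w i * sg q i, mu / 2)) L).
  assert (Haw : forall j s, (j < n)%nat -> (s < n)%nat -> Rabs (a j s) <= w s).
  { intros j s Hj Hs; unfold a; destruct (HB j s Hj Hs); destruct (Hcb j Hj).
    rewrite Rabs_mult, (Rabs_pos_eq (w s)) by apply Hw, Hs.
    assert (Rabs (B j s - cbar j) <= 1) by (apply Rabs_le; lra).
    specialize (Hw s Hs); nra. }
  destruct (random_signs n w v LL) as [s [Hs1 Hs]].
  - exact Hv.
  - apply Rle_trans with (x * mu).
    + unfold mu; rewrite <- sumR_scal; apply sumR_le; intros i Hi.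
      eapply light_bounds; eauto.
    + unfold v; apply Rmult_le_reg_r with m; [exact Hm|].
      replace (mu ^ 2 / m * m) with (mu ^ 2) by (field; lra); nra.
  - intros b t Hin; unfold LL in Hin; rewrite !in_app_iff, !in_map_iff in Hin.
    assert (0 <= tau * mu) by nra.
    assert (Hwa : forall i, (i < n)%nat -> Rabs (w i) <= w i)
      by (intros; rewrite Rabs_pos_eq; [lra|apply Hw; auto]).
    destruct Hin as [[E|[E|[]]]|[[j [E Hj]]|[[j [E Hj]]|[q [E Hq]]]]]; inversion E; subst;
      (split; [lra|]); intros i Hi; try apply in_range in Hj.
    + apply Hwa, Hi.
    + rewrite Rabs_Ropp; apply Hwa, Hi.
    + auto.
    + rewrite Rabs_Ropp; auto.
    + rewrite Rabs_mult; unfold sg; specialize (Hwa i Hi).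
      destruct (Rle_dec 0 (q i - p i)); [rewrite Rabs_R1|rewrite (Rabs_left (-1)) by lra]; lra.
  (* The [2 * n + 2] mass and payoff events contribute [/ INR n ^ 4] each, and all events for [L]
     together at most as much as one of them. *)
  - unfold LL; rewrite !lsum_app, !lsum_map; unfold lsum at 1; cbn [map fold_right snd].
    rewrite !lsum_const, length_seq.
    assert (E1 : exp (- ((tau * mu) ^ 2 / (8 * v))) = / INR n ^ 4).
    { rewrite <- exp_neg_nat_ln by assumption; f_equal; f_equal.
      unfold tau, v, m, granularity; simpl INR; field; repeat split; lra. }
    assert (E2 : exp (- ((mu / 2) ^ 2 / (8 * v))) = exp (- (4624 * (Delta / eps) ^ 2 * ln (INR n)))).
    { f_equal; f_equal; unfold v, m, granularity; field; repeat split; lra. }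
    rewrite E1, E2.
    assert (E3 : INR (length L) * exp (- (4624 * (Delta / eps) ^ 2 * ln (INR n))) <= / INR n ^ 4).
    { eapply Rle_trans; [apply Rmult_le_compat_r; [left; apply exp_pos|exact HL]|].
      unfold Rpower; rewrite <- exp_plus, <- exp_neg_nat_ln by assumption.
      apply exp_le_compat; simpl INR; nra. }
    assert (Hn2 := INR_ge2 n Hn).
    assert (0 < / INR n ^ 4) by (apply Rinv_0_lt_compat, pow_lt; lra).
    assert ((2 * INR n + 3) * / INR n ^ 4 < 1).
    { apply Rmult_lt_reg_r with (INR n ^ 4); [apply pow_lt; lra|].
      rewrite Rmult_assoc, Rinv_l by (apply pow_nonzero; lra).
      assert (4 <= INR n ^ 2) by nra.
      replace (INR n ^ 4) with (INR n ^ 2 * INR n ^ 2) by ring; nra. }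
    nra.
  - set (dl := 17 * Delta / mu).
    assert (Hdmu : dl * mu = 17 * Delta) by (unfold dl; field; lra).
    assert (Hdl : 0 < dl <= / 2) by (split; nra).
    set (A := sumR n (fun i => w i * s i) / mu).
    assert (HAmu : sumR n (fun i => w i * s i) = A * mu) by (unfold A; field; lra).
    assert (HA : - tau < A < tau).
    { assert (H1 := Hs w (tau * mu)); assert (H2 := Hs (fun i => - w i) (tau * mu)).
      rewrite HAmu in H1.
      rewrite (sumR_ext n _ (fun i => (-1) * (w i * s i))), sumR_scal, HAmu in H2
        by (intros; ring).
      specialize (H1 (or_introl eq_refl)); specialize (H2 (or_intror (or_introl eq_refl))).
      split; nra. }
    set (p' := fun i => p i + dl * (w i * s i - A * w i)).
    assert (Hsb : forall i, -1 <= s i <= 1) by (intros i; destruct (Hs1 i); lra).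
    destruct Hp as [Hp0 Hp1].
    destruct (Hcov p') as [q [HqL Hq]].
    + split.
      * intros i Hi; unfold p'; specialize (Hw i Hi); specialize (Hsb i).
        assert (- 2 <= s i - A) by lra.
        assert (dl * (w i * (s i - A)) >= dl * (w i * -2)).
        { apply Rmult_ge_compat_l; [lra|]; apply Rmult_ge_compat_l; lra. }
        nra.
      * unfold p'; rewrite sumR_plus, sumR_scal, sumR_minus, sumR_scal, HAmu; fold mu.
        rewrite Hp1; ring.
    + intros i Hi Hpos; apply Rnot_le_lt; intros Hle; unfold p' in Hpos.
      specialize (Hw i Hi); specialize (Hp0 i Hi).
      assert (Hwi : w i = 0) by lra; rewrite Hwi in Hpos; nra.
    + intros j Hj.
      replace (row_pay n B j p' - row_pay n B j p) with (dl * sumR n (fun i => a j i * s i)).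
      2:{ unfold row_pay; rewrite <- sumR_minus; symmetry.
          rewrite (sumR_ext n (fun i => a j i * s i) (fun i => w i * B j i * s i - cbar j * (w i * s i)))
            by (intros; unfold a; ring).
          rewrite (sumR_ext n _ (fun i => dl * (w i * B j i * s i - A * (w i * B j i))))
            by (intros; unfold p'; ring).
          rewrite sumR_scal, !sumR_minus, !sumR_scal, HAmu, Hcmu; ring. }
      assert (H1 : sumR n (fun i => a j i * s i) < tau * mu).
      { apply Hs; unfold LL; rewrite !in_app_iff, !in_map_iff.
        right; left; exists j; split; [reflexivity|apply range_in, Hj]. }
      assert (H2 : - sumR n (fun i => a j i * s i) < tau * mu).
      { replace (- sumR n (fun i => a j i * s i)) with (sumR n (fun i => - a j i * s i)).
        - apply (Hs (fun i => - a j i)); unfold LL; rewrite !in_app_iff, !in_map_iff.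
          right; right; left; exists j; split; [reflexivity|apply range_in, Hj].
        - rewrite (sumR_ext n _ (fun i => (-1) * (a j i * s i))), sumR_scal by (intros; ring).
          ring. }
      assert (E : dl * (tau * mu) = eps / 4).
      { replace (dl * (tau * mu)) with (dl * mu * tau) by ring; rewrite Hdmu; unfold tau; field; lra. }
      apply Rabs_le; split; nra.
    + assert (H1 : sumR n (fun i => w i * sg q i * s i) < mu / 2).
      { apply (Hs (fun i => w i * sg q i)); unfold LL; rewrite !in_app_iff, !in_map_iff.
        right; right; right; exists q; auto. }
      (* Where the sign opposes [sg], the coordinate moves away from [q] by at least
         [dl * w i * (1 - / 68)]; elsewhere the bound is not positive. In total the sum exceeds
         [17 * Delta * (1 / 4 - / 68) = 4 * Delta], so the distance exceeds [2 * Delta]. *)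
      assert (H2 : dl / 2 * (mu - sumR n (fun i => w i * sg q i * s i)) - dl * / 68 * mu
                 <= sumR n (fun i => Rabs (p' i - q i))).
      { unfold mu; rewrite <- sumR_minus, <- !sumR_scal, <- sumR_minus; apply sumR_le; intros i Hi.
        specialize (Hw i Hi); unfold p', sg.
        assert (HAw : - (/ 68 * w i) <= A * w i <= / 68 * w i) by (split; nra).
        assert (HAd : - (dl * (/ 68 * w i)) <= dl * (A * w i) <= dl * (/ 68 * w i)) by (split; nra).
        assert (0 <= dl * w i) by nra.
        destruct (Rle_dec 0 (q i - p i)); destruct (Hs1 i) as [-> | ->];
          unfold Rabs; destruct (Rcase_abs _); nra. }
      unfold Defs.dist in Hq; nra.
Qed.

(** * Counting heavy strategies over dyadic thresholds *)

Definition heavy_count (n : nat) (p : vec) (x : R) : R :=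
  sumR n (fun i => if Rle_dec (p i) x then 0 else 1).

Lemma heavy_count_inv n p m :
  is_strategy n p -> 0 < m -> heavy_count n p (/ m) <= m.
Proof.
  intros [H0 H1] Hm; apply Rle_trans with (sumR n (fun i => m * p i)).
  - apply sumR_le; intros i Hi; specialize (H0 i Hi).
    destruct (Rle_dec (p i) (/ m)) as [Hle|Hgt]; [nra|].
    apply Rnot_le_lt in Hgt; apply Rmult_lt_compat_l with (r := m) in Hgt; [|exact Hm].
    rewrite Rinv_r in Hgt; lra.
  - rewrite sumR_scal, H1; lra.
Qed.

Lemma heavy_count_half n p y : is_strategy n p -> 0 < y ->
  heavy_count n p (y / 2) <= heavy_count n p y + 2 / y * sumR n (light p y).
Proof.
  intros [H0 _] Hy; unfold heavy_count; rewrite <- sumR_scal, <- sumR_plus.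
  apply sumR_le; intros i Hi; specialize (H0 i Hi); unfold light.
  assert (0 < 2 / y) by (apply Rdiv_lt_0_compat; lra).
  destruct (Rle_dec (p i) y) as [H1|H1]; destruct (Rle_dec (p i) (y / 2)) as [H2|H2]; try nra.
  apply Rnot_le_lt in H2; apply Rmult_lt_compat_l with (r := 2 / y) in H2; [|lra].
  replace (2 / y * (y / 2)) with 1 in H2 by (field; lra); lra.
Qed.

(** At threshold [z / m] with [Delta <= z], the light mass is at most [34 * z] whether or not it
    reaches [34 * Delta]. Entries in the next dyadic range exceed [z / (2 * m)], so each halving
    adds at most [68 * m] of them. *)
Lemma heavy_count_dyadic n p m Delta k :
  is_strategy n p -> 0 < m -> 0 < Delta ->
  (forall x, 34 * Delta <= sumR n (light p x) -> sumR n (light p x) < x * m) ->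
  Delta <= 2 * (/ 2) ^ k ->
  heavy_count n p ((/ 2) ^ k / m) <= m + 68 * m * INR k.
Proof.
  intros Hp Hm HD Hlight; induction k as [|k IH]; intros Hk.
  - unfold Rdiv; rewrite pow_O, Rmult_1_l; pose proof (heavy_count_inv n p m Hp Hm); simpl; lra.
  - rewrite <- tech_pow_Rmult in *.
    set (z := (/ 2) ^ k) in *; assert (Hz : 0 < z) by (apply pow_lt; lra).
    assert (Hy : 0 < z / m) by (apply Rdiv_lt_0_compat; lra).
    replace (/ 2 * z / m) with (z / m / 2) by (field; lra).
    eapply Rle_trans; [apply heavy_count_half; assumption|].
    assert (Hmass : sumR n (light p (z / m)) <= 34 * z).
    { destruct (Rle_lt_dec (34 * Delta) (sumR n (light p (z / m)))) as [H|H]; [|lra].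
      apply Hlight in H; replace (z / m * m) with z in H by (field; lra); lra. }
    assert (2 / (z / m) * sumR n (light p (z / m)) <= 68 * m).
    { replace (68 * m) with (2 / (z / m) * (34 * z)) by (field; lra).
      apply Rmult_le_compat_l; [|exact Hmass].
      left; apply Rdiv_lt_0_compat; lra. }
    rewrite S_INR; specialize (IH ltac:(lra)); lra.
Qed.

Lemma dyadic_scale Delta : 0 < Delta -> Delta <= 1 ->
  exists k, (/ 2) ^ k <= Delta <= 2 * (/ 2) ^ k.
Proof.
  intros H0 H1.
  assert (Hind : forall N, (/ 2) ^ N <= Delta -> exists k, (/ 2) ^ k <= Delta <= 2 * (/ 2) ^ k).
  { induction N as [|N IH]; intros HN.
    - exists O; simpl in *; lra.
    - destruct (Rle_lt_dec ((/ 2) ^ N) Delta) as [H|H]; [auto|].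
      exists (S N); simpl in *; lra. }
  destruct (pow_lt_1_zero (/ 2)) with (y := Delta) as [N HN]; [rewrite Rabs_pos_eq; lra|lra|].
  apply (Hind N); specialize (HN N (le_n N)); apply Rabs_def2 in HN; lra.
Qed.

Lemma ln_le x y : 0 < x -> x <= y -> ln x <= ln y.
Proof.
  intros Hx [H| ->]; [left; apply ln_increasing; assumption|right; reflexivity].
Qed.

Lemma ln_1_inv_ge Delta : 0 < Delta -> Delta <= 1 -> 1 / 2 <= ln (1 + / Delta).
Proof.
  intros H0 H1; pose proof ln_lt_2.
  assert (1 <= / Delta) by (rewrite <- Rinv_1; apply Rinv_le_contravar; lra).
  assert (ln 2 <= ln (1 + / Delta)) by (apply ln_le; lra); lra.
Qed.

Lemma dyadic_exponent_le Delta k : 0 < Delta -> Delta <= 1 -> Delta <= 2 * (/ 2) ^ k ->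
  INR k <= 4 * ln (1 + / Delta).
Proof.
  intros H0 H1 Hk; pose proof ln_lt_2.
  assert (1 <= / Delta) by (rewrite <- Rinv_1; apply Rinv_le_contravar; lra).
  assert (ln 2 <= ln (1 + / Delta)) by (apply ln_le; lra).
  assert (ln (/ Delta) <= ln (1 + / Delta)) by (apply ln_le; lra).
  rewrite ln_Rinv in * by lra.
  apply ln_le in Hk; [|exact H0].
  rewrite ln_mult, ln_pow, ln_Rinv in Hk by (try apply pow_lt; lra).
  pose proof (pos_INR k); nra.
Qed.

Lemma supp_size_sumR n p :
  INR (supp_size n p) = sumR n (fun i => if Rlt_dec 0 (p i) then 1 else 0).
Proof.
  unfold supp_size, sumR; induction (seq 0 n) as [|i l IH]; [reflexivity|].
  simpl; destruct (Rlt_dec 0 (p i)).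
  - change (INR (S (length (filter (fun i => if Rlt_dec 0 (p i) then true else false) l)))
      = 1 + fold_right Rplus 0 (map (fun i => if Rlt_dec 0 (p i) then 1 else 0) l)).
    rewrite S_INR, IH; lra.
  - rewrite IH; lra.
Qed.

(** Sampling [T] pure strategies from [r]: with [24 = 3 * 8], each of the [2 * n] one-sided events
    has bound at most [/ INR n ^ 3]. *)
Lemma empirical_payoffs n B r eta T :
  (2 <= n)%nat -> entries01 n B -> is_strategy n r -> 0 < eta ->
  24 * ln (INR n) <= INR T * eta ^ 2 ->
  exists o : nat -> nat, (forall s, (s < T)%nat -> (o s < n)%nat /\ 0 < r (o s)) /\
    forall j, (j < n)%nat ->
      Rabs (sumR T (fun s => B j (o s)) - INR T * row_pay n B j r) <= INR T * eta.
Proof.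
  intros Hn HB Hr Heta HT.
  assert (Hln := ln_INR_gt n Hn); assert (Hn2 := INR_ge2 n Hn).
  assert (HT0 : 0 < INR T) by nra.
  set (sgn := fun b : bool => if b then 1 else -1).
  assert (Hb : forall j, (j < n)%nat -> 0 <= row_pay n B j r <= 1).
  { intros j Hj; destruct Hr as [H0 H1]; split.
    - apply sumR_ge0; intros i Hi; apply Rmult_le_pos; [apply HB|]; auto.
    - rewrite <- H1; apply sumR_le; intros i Hi; specialize (H0 i Hi); destruct (HB j i Hj Hi); nra. }
  destruct (simultaneous_deviation
     (map (fun j => (j, true)) (seq 0 n) ++ map (fun j => (j, false)) (seq 0 n))
     n T (fun _ => r) (fun f _ o => sgn (snd f) * (B (fst f) o - row_pay n B (fst f) r))
     (fun _ => 1) (INR T) (fun _ => INR T * eta)) as [o [Ho Hdev]].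
  - exact HT0.
  - rewrite sumR_const; lra.
  - auto.
  - intros f s _ _; destruct Hr as [_ H1].
    rewrite (sumR_ext n _ (fun o => sgn (snd f) * (B (fst f) o * r o - row_pay n B (fst f) r * r o)))
      by (intros; ring).
    rewrite sumR_scal, sumR_minus, sumR_scal, H1; unfold row_pay; ring.
  - intros f s o Hf _ Ho.
    assert (Hj : (fst f < n)%nat).
    { rewrite in_app_iff, !in_map_iff in Hf.
      destruct Hf as [[j [<- Hj]]|[j [<- Hj]]]; apply in_range, Hj. }
    destruct (HB _ _ Hj Ho); destruct (Hb _ Hj).
    unfold sgn; destruct (snd f); apply Rabs_le; lra.
  - intros f _; nra.
  - rewrite lsum_app, !lsum_map, !lsum_const, length_seq.
    assert (exp (- ((INR T * eta) ^ 2 / (8 * INR T))) <= / INR n ^ 3).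
    { rewrite <- exp_neg_nat_ln by assumption; apply exp_le_compat; simpl INR.
      replace ((INR T * eta) ^ 2 / (8 * INR T)) with (INR T * eta ^ 2 / 8) by (field; lra).
      lra. }
    assert (2 * INR n * / INR n ^ 3 < 1).
    { apply Rmult_lt_reg_r with (INR n ^ 3); [apply pow_lt; lra|].
      rewrite Rmult_assoc, Rinv_l by (apply pow_nonzero; lra); nra. }
    nra.
  - exists o; split; [exact Ho|]; intros j Hj.
    assert (E : sumR T (fun s => B j (o s) - row_pay n B j r)
      = sumR T (fun s => B j (o s)) - INR T * row_pay n B j r)
      by (rewrite sumR_minus, sumR_const; reflexivity).
    pose proof (Hdev (j, true)) as H1; pose proof (Hdev (j, false)) as H2.
    rewrite in_app_iff, !in_map_iff in H1, H2; cbn [fst snd sgn] in H1, H2.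
    rewrite sumR_scal, E in H1, H2.
    specialize (H1 (or_introl (ex_intro _ j (conj eq_refl (range_in _ _ Hj))))).
    specialize (H2 (or_intror (ex_intro _ j (conj eq_refl (range_in _ _ Hj))))).
    apply Rabs_le; lra.
Qed.

Lemma exists_nat_ceil x : 0 <= x -> exists T, x <= INR T <= x + 1.
Proof.
  intros Hx; destruct (archimed x) as [H1 H2].
  assert (H3 : (0 <= up x)%Z) by (apply le_IZR; lra).
  exists (Z.to_nat (up x)); rewrite INR_IZR_INZ, Z2Nat.id by exact H3; lra.
Qed.

(** Entries above [x] are kept; the light part is replaced by an empirical average of the same mass.
    As this mass is below [34 * Delta], sampling precision [eps / (272 * Delta)] suffices for
    [eps / 8]. *)
Lemma sparsify n B p x eps Delta :
  (2 <= n)%nat -> 0 < eps -> eps <= Delta -> entries01 n B -> is_strategy n p ->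
  sumR n (light p x) < 34 * Delta ->
  exists p', is_strategy n p' /\
    (forall i, (i < n)%nat -> 0 < p' i -> 0 < p i) /\
    (forall j, (j < n)%nat -> Rabs (row_pay n B j p' - row_pay n B j p) <= eps / 8) /\
    INR (supp_size n p') <= heavy_count n p x + 1775618 * (Delta / eps) ^ 2 * ln (INR n).
Proof.
  intros Hn He HeD HB Hp Hlam.
  set (w := light p x) in *; set (lam := sumR n w) in *.
  assert (Hln := ln_INR_gt n Hn); assert (Hr := ratio_sq_ge1 eps Delta He HeD).
  assert (Hw : forall i, (i < n)%nat -> 0 <= w i <= p i) by (intros; eapply light_bounds; eauto).
  destruct (Rle_lt_dec lam 0) as [Hz|Hpos].
  - exists p; split; [exact Hp|]; split; [auto|]; split.
    + intros j Hj; unfold Rminus; rewrite Rplus_opp_r, Rabs_R0; lra.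
    + rewrite supp_size_sumR.
      assert (sumR n (fun i => if Rlt_dec 0 (p i) then 1 else 0) <= heavy_count n p x); [|nra].
      apply sumR_le; intros i Hi.
      assert (Hwi : w i <= 0).
      { eapply Rle_trans; [apply (sumR_term_le n w i); [apply Hw|exact Hi]|exact Hz]. }
      unfold w, light in Hwi.
      destruct (Rlt_dec 0 (p i)); destruct (Rle_dec (p i) x); lra.
  - set (r := fun i => w i / lam); set (eta := eps / (272 * Delta)).
    assert (Hrs : is_strategy n r).
    { split; [intros i Hi; apply Rle_mult_inv_pos; [apply Hw, Hi|exact Hpos]|].
      rewrite (sumR_ext n r (fun i => / lam * w i)), sumR_scal by (intros; unfold r; field; lra).
      fold lam; field; lra. }
    assert (Heta : 0 < eta) by (apply Rdiv_lt_0_compat; lra).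
    (* [1775616 = 24 * 272 ^ 2]; rounding up costs 1, absorbed by the constant 1775618 because
       [ln (INR n) > 1 / 2]. *)
    destruct (exists_nat_ceil (1775616 * (Delta / eps) ^ 2 * ln (INR n))) as [T [HT1 HT2]]; [nra|].
    assert (HT0 : 0 < INR T) by nra.
    destruct (empirical_payoffs n B r eta T) as [o [Ho Hdev]]; auto.
    { apply Rmult_le_compat_r with (r := eta ^ 2) in HT1; [|nra].
      eapply Rle_trans; [|exact HT1]; apply Req_le; unfold eta; field; lra. }
    set (hits := fun i => sumR T (fun s => if Nat.eq_dec i (o s) then 1 else 0)).
    assert (Hh0 : forall i, 0 <= hits i).
    { intros i; apply sumR_ge0; intros s _; destruct (Nat.eq_dec i (o s)); lra. }
    assert (Hhsum : forall c, sumR n (fun i => c i * hits i) = sumR T (fun s => c (o s))).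
    { intros c; unfold hits.
      rewrite (sumR_ext n _ (fun i => sumR T (fun s => if Nat.eq_dec i (o s) then c i else 0))).
      - rewrite sumR_swap; apply sumR_ext; intros s Hs; apply sumR_single, Ho, Hs.
      - intros i _; rewrite <- sumR_scal; apply sumR_ext; intros s _.
        destruct (Nat.eq_dec i (o s)); lra. }
    assert (Hhpos : forall i, (i < n)%nat -> 0 < hits i -> 0 < p i).
    { intros i Hi Hh; apply Rnot_le_lt; intros Hle.
      assert (hits i <= 0); [|lra].
      rewrite <- (Rmult_0_r (INR T)), <- sumR_const; apply sumR_le; intros s Hs.
      destruct (Nat.eq_dec i (o s)) as [->|]; [|lra]; exfalso.
      destruct (Ho s Hs) as [Ho1 Ho2]; unfold r in Ho2.
      assert (w (o s) = 0) as E by (specialize (Hw _ Ho1); lra); rewrite E in Ho2.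
      unfold Rdiv in Ho2; rewrite Rmult_0_l in Ho2; lra. }
    assert (Hlt : 0 < lam / INR T) by (apply Rdiv_lt_0_compat; assumption).
    exists (fun i => p i - w i + lam / INR T * hits i); repeat split.
    + intros i Hi; specialize (Hw i Hi); specialize (Hh0 i); nra.
    + rewrite sumR_plus, sumR_minus, sumR_scal.
      rewrite (sumR_ext n hits (fun i => 1 * hits i)), (Hhsum (fun _ => 1)), sumR_const
        by (intros; ring).
      destruct Hp as [_ ->]; fold lam; field; lra.
    + intros i Hi Hp'; specialize (Hw i Hi).
      destruct (Rle_lt_dec (hits i) 0) as [H|H]; [|auto].
      assert (hits i = 0) as E by (specialize (Hh0 i); lra); rewrite E in Hp'; lra.
    + intros j Hj; specialize (Hdev j Hj).
      assert (E : row_pay n B j (fun i => p i - w i + lam / INR T * hits i) - row_pay n B j p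
        = lam / INR T * (sumR T (fun s => B j (o s)) - INR T * row_pay n B j r)).
      { unfold row_pay; rewrite <- (Hhsum (fun i => B j i)), <- sumR_minus.
        rewrite (sumR_ext n _ (fun i => lam / INR T * (B j i * hits i) - B j i * w i))
          by (intros; ring).
        rewrite sumR_minus, sumR_scal.
        rewrite (sumR_ext n (fun i => B j i * w i) (fun i => lam * (B j i * r i))), sumR_scal
          by (intros; unfold r; field; lra).
        field; lra. }
      rewrite E, Rabs_mult, (Rabs_pos_eq (lam / INR T)) by lra.
      apply Rle_trans with (lam / INR T * (INR T * eta)); [apply Rmult_le_compat_l; lra|].
      replace (lam / INR T * (INR T * eta)) with (lam * eta) by (field; lra).
      replace (eps / 8) with (34 * Delta * eta) by (unfold eta; field; lra); nra.
    + rewrite supp_size_sumR.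
      (* A support element that is not heavy has been sampled at least once. *)
      apply Rle_trans with (heavy_count n p x + INR T); [|nra].
      replace (INR T) with (sumR n hits).
      * unfold heavy_count; rewrite <- sumR_plus; apply sumR_le; intros i Hi; specialize (Hh0 i).
        assert (Hi1 : 0 < hits i -> 1 <= hits i).
        { intros Hh; apply Rnot_lt_le; intros H1.
          assert (hits i <= 0); [|lra].
          rewrite <- (Rmult_0_r (INR T)), <- sumR_const; apply sumR_le; intros s Hs.
          destruct (Nat.eq_dec i (o s)) as [E|]; [|lra]; exfalso.
          apply (Rlt_not_le _ _ H1).
          replace 1 with (if Nat.eq_dec i (o s) then 1 else 0) by (destruct (Nat.eq_dec i (o s)); tauto).
          apply (sumR_term_le T (fun s => if Nat.eq_dec i (o s) then 1 else 0)); [|exact Hs].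
          intros s' _; destruct (Nat.eq_dec i (o s')); lra. }
        unfold w, light.
        destruct (Rle_dec (p i) x); destruct (Rlt_dec 0 _) as [H|H]; try lra.
        destruct (Rle_lt_dec (hits i) 0) as [H'|H']; [|apply Hi1 in H'; lra].
        assert (hits i = 0) as E by lra; rewrite E in H; lra.
      * rewrite (sumR_ext n hits (fun i => 1 * hits i)), (Hhsum (fun _ => 1)), sumR_const
          by (intros; ring); ring.
Qed.

Lemma sparse_response n B p eps Delta L :
  (2 <= n)%nat -> 0 < eps -> eps <= Delta -> Delta <= 1 -> entries01 n B -> is_strategy n p ->
  covered n B p (eps / 4) Delta L ->
  INR (length L) <= Rpower (INR n) ((Delta / eps) ^ 2) ->
  exists p', is_strategy n p' /\
    (forall i, (i < n)%nat -> 0 < p' i -> 0 < p i) /\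
    (forall j, (j < n)%nat -> Rabs (row_pay n B j p' - row_pay n B j p) <= eps / 8) /\
    INR (supp_size n p') <= 10 ^ 8 * (Delta / eps) ^ 2 * ln (1 + / Delta) * ln (INR n).
Proof.
  intros Hn He HeD HD1 HB Hp Hcov HL.
  assert (HD : 0 < Delta) by lra.
  assert (Hln := ln_INR_gt n Hn); assert (Hr := ratio_sq_ge1 eps Delta He HeD).
  assert (HLam := ln_1_inv_ge Delta HD HD1).
  set (m := granularity n eps Delta).
  assert (Hm : 0 < m) by (unfold m, granularity; nra).
  assert (Hlight : forall x, 34 * Delta <= sumR n (light p x) -> sumR n (light p x) < x * m)
    by (intros; eapply light_mass_lt; eauto).
  destruct (dyadic_scale Delta HD HD1) as [k [Hk1 Hk2]].
  destruct (sparsify n B p ((/ 2) ^ k / m) eps Delta) as [p' [H1 [H2 [H3 H4]]]]; auto.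
  (* A light mass of at least [34 * Delta] would be below [(/ 2) ^ k], which is at most [Delta]. *)
  - apply Rnot_le_lt; intros H; specialize (Hlight _ H).
    replace ((/ 2) ^ k / m * m) with ((/ 2) ^ k) in Hlight by (field; lra); lra.
  - exists p'; repeat split; auto; try apply H1.
    eapply Rle_trans; [exact H4|].
    pose proof (heavy_count_dyadic n p m Delta k Hp Hm HD Hlight Hk2) as H5.
    pose proof (dyadic_exponent_le Delta k HD HD1 Hk2) as H6.
    set (Lam := ln (1 + / Delta)) in *; set (K := (Delta / eps) ^ 2 * ln (INR n)).
    assert (HK : 0 < K) by (unfold K; nra).
    assert (Em : m = 147968 * K) by (unfold m, granularity, K; ring).
    replace (10 ^ 8 * (Delta / eps) ^ 2 * Lam * ln (INR n)) with (100000000 * (K * Lam))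
      by (unfold K; ring).
    replace (1775618 * (Delta / eps) ^ 2 * ln (INR n)) with (1775618 * K) by (unfold K; ring).
    assert (K * INR k <= 4 * (K * Lam)) by nra.
    assert (K <= 2 * (K * Lam)) by nra.
    rewrite Em in H5 at 2 3; lra.
Qed.

(** * Existence of approximate equilibria *)

Lemma exists_argmax n (f : nat -> R) : (1 <= n)%nat ->
  exists i, (i < n)%nat /\ forall j, (j < n)%nat -> f j <= f i.
Proof.
  induction n as [|n IH]; intros Hn; [lia|].
  destruct (Nat.eq_dec n 0) as [->|Hn0].
  - exists O; split; [lia|]; intros j Hj; replace j with O by lia; lra.
  - destruct IH as [i [Hi Hmax]]; [lia|].
    destruct (Rle_lt_dec (f n) (f i)) as [H|H].
    + exists i; split; [lia|]; intros j Hj.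
      destruct (Nat.eq_dec j n) as [->|]; [exact H|apply Hmax; lia].
    + exists n; split; [lia|]; intros j Hj.
      destruct (Nat.eq_dec j n) as [->|]; [lra|].
      assert (f j <= f i) by (apply Hmax; lia); lra.
Qed.

Lemma INR_list_sum n (x : nat -> nat) :
  INR (list_sum (map x (seq 0 n))) = sumR n (fun i => INR (x i)).
Proof.
  unfold sumR; induction (seq 0 n) as [|i l IH]; [reflexivity|].
  change (INR (x i + list_sum (map x l)) = INR (x i) + fold_right Rplus 0 (map (fun i => INR (x i)) l)).
  rewrite plus_INR, IH; reflexivity.
Qed.

Lemma row_pay_scal n A i c x : row_pay n A i (fun k => c * x k) = c * row_pay n A i x.
Proof. unfold row_pay; rewrite <- sumR_scal; apply sumR_ext; intros; ring. Qed.

Lemma row_pay_lipschitz n A i x y c r :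
  (forall j, (j < n)%nat -> Rabs (A i j) <= c) ->
  (forall j, (j < n)%nat -> Rabs (x j - y j) <= r) ->
  Rabs (row_pay n A i x - row_pay n A i y) <= INR n * (c * r).
Proof.
  intros HA Hxy; unfold row_pay; rewrite <- sumR_minus, <- sumR_const.
  eapply Rle_trans; [apply sumR_abs|]; apply sumR_le; intros j Hj.
  rewrite <- Rmult_minus_distr_l, Rabs_mult.
  apply Rmult_le_compat; auto using Rabs_pos.
Qed.

Lemma Rabs_le_inv x y : Rabs x <= y -> - y <= x <= y.
Proof. unfold Rabs; destruct (Rcase_abs x); lra. Qed.

(* Colour each grid point of the simplex by a best response to it. *)
Lemma approx_symmetric_equilibrium n A c delta :
  (2 <= n)%nat -> 0 < delta ->
  (forall i j, (i < n)%nat -> (j < n)%nat -> Rabs (A i j) <= c) ->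
  exists x, is_strategy n x /\
    forall i, (i < n)%nat -> 0 < x i ->
    forall j, (j < n)%nat -> row_pay n A j x <= row_pay n A i x + delta.
Proof.
  intros Hn Hd HA.
  assert (Hc : 0 <= c).
  { eapply Rle_trans; [apply (Rabs_pos (A O O))|apply HA; lia]. }
  assert (Hnp : 2 <= INR n) by apply INR_ge2, Hn.
  (* Grid neighbours differ by at most [n] per coordinate, which shifts a payoff difference by at
     most [z]. Dividing by [D] brings this below [delta]. *)
  set (z := 2 * (INR n * (c * INR n))).
  assert (Hz : 0 <= z / delta).
  { apply Rle_mult_inv_pos; [|exact Hd].
    assert (0 <= INR n * (c * INR n)) by (repeat apply Rmult_le_pos; lra); unfold z; lra. }
  destruct (exists_nat_ceil (z / delta + 1)) as [D [HD _]]; [lra|].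
  assert (HDbound : z <= INR D * delta).
  { replace z with (z / delta * delta) by (field; lra); apply Rmult_le_compat_r; lra. }
  assert (HD0 : 0 < INR D) by lra.
  destruct (@Scarf.grid_scarf n D (fun y i => forall j, (j < n)%nat ->
     row_pay n A j (fun k => INR (y k)) <= row_pay n A i (fun k => INR (y k)))) as [x [Hsum Hx]].
  - exact Hn.
  - intros y _; apply (exists_argmax n (fun i => row_pay n A i (fun k => INR (y k)))); lia.
  - assert (HDinv : 0 < / INR D) by (apply Rinv_0_lt_compat, HD0).
    exists (fun k => / INR D * INR (x k)); split.
    + split; [intros i _; pose proof (pos_INR (x i)); nra|].
      rewrite sumR_scal, <- INR_list_sum, Hsum; field; lra.
    + intros i Hi Hpos j Hj; rewrite !row_pay_scal.
      destruct (Hx i Hi) as [y [Hy Hclose]].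
      { apply INR_lt; simpl INR; pose proof (pos_INR (x i)); nra. }
      assert (Hdist : forall k, (k < n)%nat -> Rabs (INR (x k) - INR (y k)) <= INR n).
      { intros k Hk; destruct (Hclose k Hk) as [H1 H2].
        apply le_INR in H1, H2; rewrite plus_INR in H1, H2; apply Rabs_le; lra. }
      specialize (Hy j Hj).
      assert (Hl : forall l, (l < n)%nat -> Rabs (row_pay n A l (fun k => INR (x k))
        - row_pay n A l (fun k => INR (y k))) <= INR n * (c * INR n)).
      { intros l Hlt; apply row_pay_lipschitz; auto. }
      pose proof (Rabs_le_inv _ _ (Hl i Hi)); pose proof (Rabs_le_inv _ _ (Hl j Hj)).
      unfold z in HDbound; apply Rmult_le_reg_l with (INR D); [exact HD0|].
      rewrite Rmult_plus_distr_l, <- !Rmult_assoc, Rinv_r by lra; lra.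
Qed.

(* The symmetrization [[0, R+1], [(C+1)^T, 0]]; the shift by 1 forces an equilibrium
   of it to put weight on both blocks. *)
Definition symmetrized (n : nat) (Rm Cm : mat) : mat := fun i k =>
  if lt_dec i n then if lt_dec k n then 0 else Rm i (k - n)%nat + 1
  else if lt_dec k n then Cm k (i - n)%nat + 1 else 0.

Lemma symmetrized_row n Rm Cm i x : (i < n)%nat ->
  row_pay (n + n) (symmetrized n Rm Cm) i x
  = row_pay n Rm i (fun k => x (n + k)%nat) + sumR n (fun k => x (n + k)%nat).
Proof.
  intros Hi; unfold row_pay, symmetrized; rewrite sumR_shift.
  destruct (lt_dec i n); [|lia].
  rewrite (sumR_ext n _ (fun _ => 0)), sumR_const, Rmult_0_r, Rplus_0_l.
  - rewrite <- sumR_plus; apply sumR_ext; intros k Hk.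
    destruct (lt_dec (n + k) n); [lia|]; replace (n + k - n)%nat with k by lia; ring.
  - intros k Hk; destruct (lt_dec k n); [ring|lia].
Qed.

Lemma symmetrized_col n Rm Cm j x : (j < n)%nat ->
  row_pay (n + n) (symmetrized n Rm Cm) (n + j) x = col_pay n Cm x j + sumR n x.
Proof.
  intros Hj; unfold row_pay, col_pay, symmetrized; rewrite sumR_shift.
  destruct (lt_dec (n + j) n); [lia|]; replace (n + j - n)%nat with j by lia.
  rewrite (sumR_ext n (fun i => _ * x (n + i)%nat) (fun _ => 0)), sumR_const, Rmult_0_r, Rplus_0_r.
  - rewrite <- sumR_plus; apply sumR_ext; intros k Hk; destruct (lt_dec k n); [ring|lia].
  - intros k Hk; destruct (lt_dec (n + k) n); [lia|ring].
Qed.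

Lemma sumR_pos_term n f : 0 < sumR n f -> exists i, (i < n)%nat /\ 0 < f i.
Proof.
  intros H; apply NNPP; intros Hn; apply (Rlt_not_le _ _ H).
  rewrite <- (Rmult_0_r (INR n)), <- sumR_const; apply sumR_le; intros i Hi.
  apply Rnot_lt_le; intros Hi0; apply Hn; exists i; auto.
Qed.

Lemma col_pay_row_pay n A p j : col_pay n A p j = row_pay n (fun j i => A i j) j p.
Proof. apply sumR_ext; intros; ring. Qed.

Lemma row_pay_bounds n A i x : entries01 n A -> (i < n)%nat ->
  (forall k, (k < n)%nat -> 0 <= x k) -> 0 <= row_pay n A i x <= sumR n x.
Proof.
  intros HA Hi Hx; split.
  - apply sumR_ge0; intros k Hk; apply Rmult_le_pos; [apply HA|]; auto.
  - apply sumR_le; intros k Hk; specialize (Hx k Hk); destruct (HA i k Hi Hk); nra.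
Qed.

Lemma entries01_transpose n A : entries01 n A -> entries01 n (fun j i => A i j).
Proof. intros H i j Hi Hj; apply H; assumption. Qed.

(** The two blocks of an approximate equilibrium of the symmetrized game, each normalised, form the
    pair. Both blocks weigh at least [1 / 4], so normalising turns the tolerance [eps / 4] into at
    most [eps]. *)
Lemma WS_eq_exists n Rm Cm eps :
  (1 <= n)%nat -> 0 < eps -> eps <= 1 -> entries01 n Rm -> entries01 n Cm ->
  exists p q, is_WS_eq n Rm Cm eps p q.
Proof.
  intros Hn He He1 HR HC.
  destruct (approx_symmetric_equilibrium (n + n) (symmetrized n Rm Cm) 2 (eps / 4))
    as [x [[Hx0 Hx1] Hbest]]; [lia|lra| |].
  { intros i j Hi Hj; unfold symmetrized.
    destruct (lt_dec i n); destruct (lt_dec j n); try (rewrite Rabs_R0; lra).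
    - destruct (HR i (j - n)%nat); [lia|lia|]; apply Rabs_le; lra.
    - destruct (HC j (i - n)%nat); [lia|lia|]; apply Rabs_le; lra. }
  set (y := fun k => x (n + k)%nat) in *.
  rewrite sumR_shift in Hx1; fold y in Hx1.
  set (U := sumR n x) in *; set (V := sumR n y) in *.
  assert (Hx : forall k, (k < n)%nat -> 0 <= x k) by (intros; apply Hx0; lia).
  assert (Hy : forall k, (k < n)%nat -> 0 <= y k) by (intros; apply Hx0; lia).
  assert (Hrow : forall i, (i < n)%nat -> 0 < x i -> forall j, (j < n)%nat ->
    row_pay n Rm j y <= row_pay n Rm i y + eps / 4).
  { intros i Hi Hpos j Hj; specialize (Hbest i ltac:(lia) Hpos j ltac:(lia)).
    rewrite !symmetrized_row in Hbest by assumption; fold y in Hbest; lra. }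
  assert (Hcol : forall i, (i < n)%nat -> 0 < y i -> forall j, (j < n)%nat ->
    col_pay n Cm x j <= col_pay n Cm x i + eps / 4).
  { intros i Hi Hpos j Hj; specialize (Hbest (n + i)%nat ltac:(lia) Hpos (n + j)%nat ltac:(lia)).
    rewrite !symmetrized_col in Hbest by assumption; lra. }
  (* Otherwise rows of the second block earn at most [2 * U < 1 / 2], those of the first at least
     [V > 3 / 4]: a gap above [eps / 4], though the second block is in the support. *)
  assert (HU : 1 / 4 <= U).
  { apply Rnot_lt_le; intros HU.
    destruct (sumR_pos_term n y) as [j [Hj Hpos]]; [fold V; lra|].
    specialize (Hbest (n + j)%nat ltac:(lia) Hpos O ltac:(lia)).
    rewrite (symmetrized_row n Rm Cm O), symmetrized_col, col_pay_row_pay in Hbest by lia.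
    fold y U in Hbest; fold V in Hbest.
    pose proof (row_pay_bounds n Rm O y HR ltac:(lia) Hy).
    pose proof (row_pay_bounds n _ j x (entries01_transpose n Cm HC) Hj Hx).
    fold U in H0; lra. }
  assert (HV : 1 / 4 <= V).
  { apply Rnot_lt_le; intros HV.
    destruct (sumR_pos_term n x) as [i [Hi Hpos]]; [fold U; lra|].
    specialize (Hbest i ltac:(lia) Hpos (n + 0)%nat ltac:(lia)).
    rewrite (symmetrized_row n Rm Cm i), symmetrized_col, col_pay_row_pay in Hbest by lia.
    fold y U in Hbest; fold V in Hbest.
    pose proof (row_pay_bounds n Rm i y HR Hi Hy).
    pose proof (row_pay_bounds n _ O x (entries01_transpose n Cm HC) ltac:(lia) Hx).
    fold V in H; lra. }
  assert (Hscale : forall W a b, 1 / 4 <= W -> a <= b + eps / 4 -> / W * b >= / W * a - eps).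
  { intros W a b HW Hab.
    assert (0 < / W) by (apply Rinv_0_lt_compat; lra).
    assert (/ W * (eps / 4) <= eps).
    { apply Rmult_le_reg_l with W; [lra|]; rewrite <- Rmult_assoc, Rinv_r by lra; nra. }
    nra. }
  assert (HUi : 0 < / U) by (apply Rinv_0_lt_compat; lra).
  assert (HVi : 0 < / V) by (apply Rinv_0_lt_compat; lra).
  exists (fun k => / U * x k), (fun k => / V * y k); repeat split.
  - intros i Hi; specialize (Hx i Hi); nra.
  - rewrite sumR_scal; fold U; field; lra.
  - intros i Hi; specialize (Hy i Hi); nra.
  - rewrite sumR_scal; fold V; field; lra.
  - intros i Hi Hpos j Hj; rewrite !row_pay_scal; apply Hscale; [exact HV|].
    apply Hrow; try assumption; specialize (Hx i Hi); nra.
  - intros i Hi Hpos j Hj; rewrite !col_pay_row_pay, !row_pay_scal, <- !col_pay_row_pay.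
    apply Hscale; [exact HU|].
    apply Hcol; try assumption; specialize (Hy i Hi); nra.
Qed.

(** * Stability *)

Lemma bil_col n A p q : bil n A p q = bil n (fun j i => A i j) q p.
Proof.
  unfold bil.
  rewrite (sumR_ext n _ (fun i => sumR n (fun j => p i * (A i j * q j))))
    by (intros; symmetry; apply sumR_scal).
  rewrite sumR_swap; apply sumR_ext; intros j _.
  rewrite <- sumR_scal; apply sumR_ext; intros; ring.
Qed.

(* Shifting each row within [eps] of the best by a constant of size at most [eps / 2] makes
   all of them exactly optimal. *)
Lemma equalizing_perturbation n A p q eps :
  (1 <= n)%nat -> 0 < eps -> is_strategy n p -> is_strategy n q ->
  (forall i, (i < n)%nat -> 0 < p i ->
     forall j, (j < n)%nat -> row_pay n A i q >= row_pay n A j q - eps) ->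
  exists rho : nat -> R, (forall i, Rabs (rho i) <= eps / 2) /\
    forall i, (i < n)%nat ->
      row_pay n (fun i j => A i j + rho i) i q <= bil n (fun i j => A i j + rho i) p q.
Proof.
  intros Hn He [Hp0 Hp1] [_ Hq1] Hws.
  set (u := fun i => row_pay n A i q).
  destruct (exists_argmax n u Hn) as [i0 [Hi0 Hmax]].
  (* Rows within [eps] of the best are moved to the common level [u i0 - eps / 2]; lower rows stay.
     The outer test covers indices beyond [n], where [u i] may exceed [u i0]. *)
  set (rho := fun i => if Rle_dec (u i) (u i0) then
     if Rle_dec (u i0 - eps) (u i) then u i0 - eps / 2 - u i else 0 else 0).
  assert (Hrow : forall i, row_pay n (fun i j => A i j + rho i) i q = u i + rho i).
  { intros i; unfold u, row_pay.
    rewrite (sumR_ext n _ (fun j => A i j * q j + rho i * q j)) by (intros; ring).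
    rewrite sumR_plus, sumR_scal, Hq1; ring. }
  exists rho; split.
  - intros i; unfold rho.
    destruct (Rle_dec (u i) (u i0)); [destruct (Rle_dec (u i0 - eps) (u i))|];
      apply Rabs_le; lra.
  - assert (Hbil : bil n (fun i j => A i j + rho i) p q = u i0 - eps / 2).
    { unfold bil; rewrite (sumR_ext n _ (fun i => (u i0 - eps / 2) * p i)).
      - rewrite sumR_scal, Hp1; ring.
      - intros i Hi; fold (row_pay n (fun i j => A i j + rho i) i q); rewrite Hrow.
        destruct (Hp0 i Hi) as [Hpos|<-]; [|ring].
        assert (H1 := Hws i Hi Hpos i0 Hi0); fold (u i) in H1; fold (u i0) in H1.
        specialize (Hmax i Hi); unfold rho.
        destruct (Rle_dec (u i) (u i0)); [|lra].
        destruct (Rle_dec (u i0 - eps) (u i)); [ring|lra]. }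
    intros i Hi; rewrite Hbil, Hrow; specialize (Hmax i Hi); unfold rho.
    destruct (Rle_dec (u i) (u i0)); [|lra].
    destruct (Rle_dec (u i0 - eps) (u i)); lra.
Qed.

Lemma perturbation_stable_WS n Rm Cm eps Delta :
  (1 <= n)%nat -> 0 < eps ->
  perturbation_stable n Rm Cm (eps / 2) Delta -> WS_approx_stable n Rm Cm eps Delta.
Proof.
  intros Hn He Hst p q [Hp [Hq [Hrow Hcol]]].
  destruct (equalizing_perturbation n Rm p q eps Hn He Hp Hq Hrow) as [rho [Hrho HNr]].
  destruct (equalizing_perturbation n (fun j i => Cm i j) q p eps Hn He Hq Hp)
    as [sigma [Hsig HNc]].
  { intros i Hi Hpos j Hj; rewrite <- !col_pay_row_pay; auto. }
  apply (Hst (fun i j => Rm i j + rho i) (fun i j => Cm i j + sigma j)).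
  - intros i j _ _; split.
    + replace (Rm i j + rho i - Rm i j) with (rho i) by ring; apply Hrho.
    + replace (Cm i j + sigma j - Cm i j) with (sigma j) by ring; apply Hsig.
  - repeat split; try apply Hp; try apply Hq; [exact HNr|].
    intros j Hj; rewrite col_pay_row_pay, bil_col; apply HNc, Hj.
Qed.

Theorem theorem2 :
  exists a b : R, 0 < a /\ 0 < b /\
  forall (n : nat) (eps Delta : R) (Rm Cm : mat),
    (2 <= n)%nat ->
    0 < eps -> eps <= Delta -> Delta <= 1 ->
    entries01 n Rm -> entries01 n Cm ->
    at_most_N_Nash n Rm Cm (Rpower (INR n) (a * (Delta / eps) ^ 2)) ->
    (WS_approx_stable n Rm Cm eps Delta \/
     perturbation_stable n Rm Cm (eps / 2) Delta) ->
    exists p q : vec, is_WS_eq n Rm Cm eps p q /\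
      INR (supp_size n p) <= b * (Delta / eps) ^ 2 * ln (1 + / Delta) * ln (INR n) /\
      INR (supp_size n q) <= b * (Delta / eps) ^ 2 * ln (1 + / Delta) * ln (INR n).
Proof.
  exists 1, (10 ^ 8); split; [lra|split; [lra|]].
  intros n eps Delta Rm Cm Hn He HeD HD1 HR HC [L [HL HN]] Hst.
  rewrite Rmult_1_l in HL.
  assert (Hws : WS_approx_stable n Rm Cm eps Delta).
  { destruct Hst as [H|H]; [exact H|]; apply perturbation_stable_WS; [lia|exact He|exact H]. }
  (* Starting from [eps / 2] leaves room for a change of [eps / 4] in both payoffs of a
     comparison. *)
  destruct (WS_eq_exists n Rm Cm (eps / 2)) as [p0 [q0 [Hp0 [Hq0 [Hrow Hcol]]]]];
    [lia|lra|lra|exact HR|exact HC|].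
  assert (Hdist : forall x y z, (forall i, (i < n)%nat -> y i = z i) ->
    Defs.dist n x y = Defs.dist n x z).
  { intros x y z H; unfold Defs.dist; f_equal; apply sumR_ext; intros i Hi.
    rewrite H by exact Hi; reflexivity. }
  destruct (sparse_response n (fun j i => Cm i j) p0 eps Delta (map fst L))
    as [p [Hp [Hpsupp [Hppay Hpsize]]]]; auto using entries01_transpose.
  { intros p' Hp' Hsupp Hpay.
    destruct (Hws p' q0) as [p1 [q1 [HNash Hclose]]].
    - split; [exact Hp'|]; split; [exact Hq0|]; split.
      + intros i Hi Hpos j Hj; specialize (Hrow i Hi (Hsupp i Hi Hpos) j Hj); lra.
      + intros i Hi Hpos j Hj; specialize (Hcol i Hi Hpos j Hj).
        rewrite !col_pay_row_pay in *.
        pose proof (Rabs_le_inv _ _ (Hpay i Hi)); pose proof (Rabs_le_inv _ _ (Hpay j Hj)); lra.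
    - destruct (HN p1 q1 HNash) as [pq [Hin Heq]]; exists (fst pq).
      split; [apply in_map, Hin|].
      rewrite <- (Hdist p' p1) by (intros i Hi; apply Heq, Hi).
      eapply Rle_trans; [apply Rmax_l|exact Hclose]. }
  { rewrite length_map; exact HL. }
  destruct (sparse_response n Rm q0 eps Delta (map snd L))
    as [q [Hq [Hqsupp [Hqpay Hqsize]]]]; auto.
  { intros q' Hq' Hsupp Hpay.
    destruct (Hws p0 q') as [p1 [q1 [HNash Hclose]]].
    - split; [exact Hp0|]; split; [exact Hq'|]; split.
      + intros i Hi Hpos j Hj; specialize (Hrow i Hi Hpos j Hj).
        pose proof (Rabs_le_inv _ _ (Hpay i Hi)); pose proof (Rabs_le_inv _ _ (Hpay j Hj)); lra.
      + intros i Hi Hpos j Hj; specialize (Hcol i Hi (Hsupp i Hi Hpos) j Hj); lra.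
    - destruct (HN p1 q1 HNash) as [pq [Hin Heq]]; exists (snd pq).
      split; [apply in_map, Hin|].
      rewrite <- (Hdist q' q1) by (intros i Hi; apply Heq, Hi).
      eapply Rle_trans; [apply Rmax_r|exact Hclose]. }
  { rewrite length_map; exact HL. }
  (* The two replacements do not interact: a player's condition involves only the support of the
     player's own strategy, which shrinks, and payoffs against the opponent's, which change by at
     most [eps / 8]. *)
  exists p, q; split; [|split; assumption].
  split; [exact Hp|]; split; [exact Hq|]; split.
  - intros i Hi Hpos j Hj; specialize (Hrow i Hi (Hpsupp i Hi Hpos) j Hj).
    pose proof (Rabs_le_inv _ _ (Hqpay i Hi)); pose proof (Rabs_le_inv _ _ (Hqpay j Hj)); lra.
  - intros i Hi Hpos j Hj; specialize (Hcol i Hi (Hqsupp i Hi Hpos) j Hj).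
    rewrite !col_pay_row_pay in *.
    pose proof (Rabs_le_inv _ _ (Hppay i Hi)); pose proof (Rabs_le_inv _ _ (Hppay j Hj)); lra.
Qed.
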